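(* Let $M:=\{(z,w)\in\mathbb{C}^2 : |z|=|w|\}\setminus\{(0,0)\}$. Then a totally real disc $K$ contained in $M$ is polynomially convex if and only if $\widehat{K}\cap\{(z,w)\in\mathbb{C}^2 : zw=0\}=\emptyset$.
   Context: For a compact $K\subset\mathbb{C}^n$, $\widehat{K}:=\{z\in\mathbb{C}^n : |p(z)|\le \sup_K|p| \text{ for all holomorphic polynomials } p\}$, and $K$ is polynomially convex if $\widehat{K}=K$. A totally real disc is a compact subset of a $C^1$-smooth submanifold $N$ of $\mathbb{C}^2$ with $T_pN\cap iT_pN=\{0\}$ for all $p\in N$, which is diffeomorphic to the closed unit disc in the plane. *)

(* Defs.v *)
From HB Require Import structures.
From mathcomp Require Import all_boot all_order all_algebra.
From mathcomp Require Import all_classical all_reals all_analysis.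
From mathcomp Require Import complex.
Set Implicit Arguments. Unset Strict Implicit. Unset Printing Implicit Defensive.
Import Order.TTheory GRing.Theory Num.Theory.
Import numFieldNormedType.Exports.
Local Open Scope classical_set_scope.
Local Open Scope ring_scope.

Section Defs.
Variable R : realType.

Definition C2 := (R[i] * R[i])%type.

Definition cmod (x : R[i]) : R := let: Complex a b := x in Num.sqrt (a ^+ 2 + b ^+ 2).

Definition hpoly_eval (n : nat) (c : nat -> nat -> R[i]) (p : C2) : R[i] :=
  \sum_(j < n) \sum_(k < n) c j k * p.1 ^+ j * p.2 ^+ k.

Definition poly_hull (K : set C2) : set C2 :=
  [set p | forall (n : nat) (c : nat -> nat -> R[i]),
     cmod (@hpoly_eval n c p) <= sup [set cmod (@hpoly_eval n c k) | k in K]].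

Definition poly_convex (K : set C2) : Prop := poly_hull K = K.

Definition toC2 (u : 'rV[R]_4) : C2 :=
  (Complex (u ord0 (0%:R : 'I_4)) (u ord0 (1%:R : 'I_4)),
   Complex (u ord0 (2%:R : 'I_4)) (u ord0 (3%:R : 'I_4))).

(* multiplication by i on C^2 = R^4 *)
Definition multJ (u : 'rV[R]_4) : 'rV[R]_4 :=
  \row_(j < 4) (if (j : nat) == 0%N then - u ord0 (1%:R : 'I_4)
                else if (j : nat) == 1%N then u ord0 (0%:R : 'I_4)
                else if (j : nat) == 2%N then - u ord0 (3%:R : 'I_4)
                else u ord0 (2%:R : 'I_4)).

Definition e2 (i : 'I_2) : 'rV[R]_2 := delta_mx ord0 i.

Definition closed_unit_disc : set 'rV[R]_2 :=
  [set x | x ord0 ord0 ^+ 2 + x ord0 (1%:R : 'I_2) ^+ 2 <= 1].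

Definition C1_on (U : set 'rV[R]_2) (phi : 'rV[R]_2 -> 'rV[R]_4) : Prop :=
  open U /\
  forall i : 'I_2, (forall x, U x -> derivable phi x (e2 i)) /\
    {within U, continuous (fun x => 'D_(e2 i) phi x)}.

(* the real tangent plane T = span(D1 phi x, D2 phi x) is 2-dimensional
   (immersion) and totally real: T /\ iT = {0} *)
Definition immersive_totally_real_at (phi : 'rV[R]_2 -> 'rV[R]_4) (x : 'rV[R]_2) :=
  let v1 := 'D_(e2 ord0) phi x in
  let v2 := 'D_(e2 (1%:R : 'I_2)) phi x in
  (forall a b : R, a *: v1 + b *: v2 = 0 -> a = 0 /\ b = 0) /\
  (forall a b c d : R, a *: v1 + b *: v2 = multJ (c *: v1 + d *: v2) ->
                       a *: v1 + b *: v2 = 0).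

Definition totally_real_disc (K : set C2) : Prop :=
  exists (U : set 'rV[R]_2) (phi : 'rV[R]_2 -> 'rV[R]_4),
    C1_on U phi /\ closed_unit_disc `<=` U /\
    {in closed_unit_disc &, injective phi} /\
    (forall x, closed_unit_disc x -> immersive_totally_real_at phi x) /\
    K = (toC2 \o phi) @` closed_unit_disc.

Definition Mcone : set C2 :=
  [set p | cmod p.1 = cmod p.2 /\ p <> (0, 0)].

Definition axes : set C2 := [set p | p.1 * p.2 = 0].

End Defs.

(* Main.v *)
(* Let X be the hull of K and suppose that X avoids the axes.  Since z and w do
   not vanish on X, their inverses are uniform limits of polynomials on X (the
   nonemptiness of spectra in a Banach algebra, applied twice, produces a zero in
   X of any polynomial without such an inverse).  As |z / w| = 1 on K, the maximum
   modulus on X of z / w and of w / z is 1, so X lies in M, and every fiber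
   z / w = const of X is contained in the hull of the same fiber of K, because
   unimodular constants are peak values.  That fiber of K is a compact subset E of
   a complex line; if its planar hull were larger than E, then w - p would have no
   continuous argument on E for some p outside E.

   On the parametrizing disc, z / w = exp (i h) with h real, and the total reality
   of K says that h has no critical point in the interior.  Hence no level set of h
   separates the plane: h would have an extremum in a bounded complementary
   component.  By Eilenberg's criterion every nonvanishing continuous function on
   a level set has a continuous argument, and so has w - p on E.  Hence X = K. *)
Require Import Defs.
From HB Require Import structures.
From mathcomp Require Import all_boot all_order all_algebra.
From mathcomp Require Import all_classical all_reals all_analysis.
From mathcomp Require Import complex.
From mathcomp Require Import ring lra.
Set Implicit Arguments. Unset Strict Implicit. Unset Printing Implicit Defensive.
Import Order.TTheory GRing.Theory Num.Theory.
Import numFieldNormedType.Exports.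
Local Open Scope classical_set_scope.
Local Open Scope ring_scope.

Local Notation re := complex.Re.
Local Notation im := complex.Im.

(** * Spectra in seminormed algebras *)

(** Two substitutions shape the proof. No completion is formed: in a Banach algebra an element is
    invertible as soon as some multiple of it lies at distance less than 1 from 1, so spectra are
    handled by seminorms on polynomials, and Liouville's theorem for the resolvent becomes a maximum
    principle for its norm, tested on four points of a circle. No theory of plane separation enters
    either: that a set winds around a point is read as the absence of a continuous argument,
    [has_arg], and this one notion serves for the holes of the fibers, for the level sets and for
    the existence of h.

    Total reality excludes extrema of h for the following reason. Along a curve in M, |z| = |w|
    forces Re (z' / z) = Re (w' / w); where arg (z / w) is extremal the imaginary parts agree too,
    and the tangent vector is a complex multiple of the position. Two such vectors, independent over
    the reals, span a complex line. Only extrema over balls inside the disc matter, because from a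
    point outside the disc the whole disc is seen in a half plane. *)

Section Modulus.
Variable R : realType.
Implicit Types x y : R[i].

Lemma cmodE x : cmod x = Normc.normc x. Proof. by case: x. Qed.

Lemma cmodM x y : cmod (x * y) = cmod x * cmod y.
Proof. by rewrite !cmodE Normc.normcM. Qed.

Lemma cmodV x : cmod x^-1 = (cmod x)^-1.
Proof. by rewrite !cmodE Normc.normcV. Qed.

Lemma cmodD x y : cmod (x + y) <= cmod x + cmod y.
Proof. by rewrite !cmodE; exact: le_normcD. Qed.

Lemma cmodN x : cmod (- x) = cmod x.
Proof. by rewrite !cmodE; exact: normcN. Qed.

Lemma cmod_ge0 x : 0 <= cmod x.
Proof. by case: x => a b /=; rewrite sqrtr_ge0. Qed.

Lemma cmod0 : cmod (0 : R[i]) = 0. Proof. by rewrite cmodE Normc.normc0. Qed.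

Lemma cmod1 : cmod (1 : R[i]) = 1. Proof. by rewrite cmodE Normc.normc1. Qed.

Lemma cmod_eq0 x : cmod x = 0 -> x = 0.
Proof. by rewrite cmodE => /Normc.eq0_normc. Qed.

Lemma cmod_gt0 x : x != 0 -> 0 < cmod x.
Proof.
by move=> x0; rewrite lt_def cmod_ge0 andbT; apply: contra x0 => /eqP /cmod_eq0 ->.
Qed.

Lemma cmodX x n : cmod (x ^+ n) = cmod x ^+ n.
Proof. by elim: n => [|n IH]; rewrite ?expr0 ?cmod1// !exprS cmodM IH. Qed.

Lemma cmod_real (a : R) : cmod a%:C%C = `|a|.
Proof. by rewrite /= expr0n /= addr0 sqrtr_sqr. Qed.

Lemma cmodi : cmod ('i%C : R[i]) = 1.
Proof. by rewrite /= expr0n /= add0r expr1n sqrtr1. Qed.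

Lemma cmod_sqr x : cmod x ^+ 2 = re x ^+ 2 + im x ^+ 2.
Proof. by case: x => a b /=; rewrite sqr_sqrtr // addr_ge0 ?sqr_ge0. Qed.

Lemma cmod_le_sum x : cmod x <= `|re x| + `|im x|.
Proof.
rewrite -(ler_pXn2r (_ : 0 < 2)%N) ?nnegrE ?cmod_ge0 ?addr_ge0 //.
rewrite cmod_sqr sqrrD -!normrX !(ger0_norm (sqr_ge0 _)).
by have := normr_ge0 (re x); have := normr_ge0 (im x); nra.
Qed.

Lemma Re_le_cmod x : `|re x| <= cmod x.
Proof.
rewrite -(ler_pXn2r (_ : 0 < 2)%N) ?nnegrE ?cmod_ge0 //.
by rewrite cmod_sqr -normrX (ger0_norm (sqr_ge0 _)) lerDl sqr_ge0.
Qed.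

Lemma Im_le_cmod x : `|im x| <= cmod x.
Proof.
rewrite -(ler_pXn2r (_ : 0 < 2)%N) ?nnegrE ?cmod_ge0 //.
by rewrite cmod_sqr -normrX (ger0_norm (sqr_ge0 _)) lerDr sqr_ge0.
Qed.

End Modulus.

(** * The resolvent and its mean value inequality *)

Section SpectrumNonempty.
Variable R : realType.
Variable A : comNzRingType.
Variable iota : {rmorphism R[i] -> A}.
Implicit Types (N : A -> R) (lam : R[i]).

(** Definiteness is not asked for, so that quotients by arbitrary ideals stay in the class. The zero
    seminorm is allowed; [1 <= N 1] later says that the algebra is not trivial. *)
Record seminorm N : Prop := Seminorm {
  seminorm_ge0 : forall x, 0 <= N x;
  seminormD : forall x y, N (x + y) <= N x + N y;
  seminormM : forall x y, N (x * y) <= N x * N y;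
  seminorm_cst : forall c, N (iota c) <= cmod c }.

Variables (N : A -> R) (semiN : seminorm N).

Lemma seminormN x : N (- x) <= N x.
Proof.
have -> : - x = iota (-1) * x by rewrite rmorphN1 mulN1r.
apply: (le_trans (seminormM semiN _ _)).
by rewrite ler_piMl ?(seminorm_ge0 semiN)// (le_trans (seminorm_cst semiN _))// cmodN cmod1.
Qed.

Lemma seminormB x y : N (x - y) <= N x + N y.
Proof. by rewrite (le_trans (seminormD semiN _ _))// lerD2l seminormN. Qed.

Lemma seminorm1 : N 1 <= 1.
Proof. by rewrite -(rmorph1 iota) (le_trans (seminorm_cst semiN _)) ?cmod1. Qed.

Lemma seminormX x n b : N x <= b -> N (x ^+ n) <= b ^+ n.
Proof.
move=> xb; elim: n => [|n IH]; first by rewrite !expr0 seminorm1.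
by rewrite !exprS (le_trans (seminormM semiN _ _))// ler_pM ?(seminorm_ge0 semiN).
Qed.

Lemma seminormM_le x y b c : N x <= b -> N y <= c -> N (x * y) <= b * c.
Proof.
by move=> xb yc; rewrite (le_trans (seminormM semiN _ _))// ler_pM ?(seminorm_ge0 semiN).
Qed.

Lemma seminormD_le x y b c : N x <= b -> N y <= c -> N (x + y) <= b + c.
Proof. by move=> xb yc; rewrite (le_trans (seminormD semiN _ _))// lerD. Qed.

Lemma seminormB_le x y b c : N x <= b -> N y <= c -> N (x - y) <= b + c.
Proof. by move=> xb yc; rewrite (le_trans (seminormB _ _))// lerD. Qed.

Lemma seminorm_sum n (F : nat -> A) (b : nat -> R) :
  (forall i, N (F i) <= b i) -> N (\sum_(i < n) F i) <= \sum_(i < n) b i.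
Proof.
move=> Fb; elim: n => [|n IH]; last first.
  by rewrite !big_ord_recr /= seminormD_le.
rewrite !big_ord0 -(rmorph0 iota) (le_trans (seminorm_cst semiN _))//.
by rewrite cmod0.
Qed.

Variable a : A.

(* [b] bounds the norm of the inverse of [a - lam] in the completion of [A] *)
Definition resolvent_bound lam (b : R) :=
  forall eps, 0 < eps -> exists g, N g <= b /\ N (1 - (a - iota lam) * g) <= eps.

Lemma resolvent_boundW lam b c :
  b <= c -> resolvent_bound lam b -> resolvent_bound lam c.
Proof.
move=> bc H e e0; have [g [gb ge]] := H e e0.
by exists g; split => //; exact: le_trans bc.
Qed.

Lemma geom_sum_le (q : R) n : 0 <= q < 1 -> \sum_(i < n) q ^+ i <= (1 - q)^-1.
Proof.
move=> /andP[q0 q1].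
rewrite -[leRHS]mul1r ler_pdivlMr ?subr_gt0// mulrC -opprB mulNr -subrX1 opprB.
by rewrite gerBl exprn_ge0.
Qed.

Lemma geometric_small (q eps : R) : 0 <= q < 1 -> 0 < eps -> exists n, q ^+ n <= eps.
Proof.
move=> /andP[q0 q1] e0.
have /(_ _)/cvgrPdist_le := @cvg_geometric R 1 q.
rewrite ger0_norm// => /(_ q1 eps e0)[n _ /(_ n (leqnn n))] /=.
rewrite /geometric /= mul1r sub0r normrN ger0_norm ?exprn_ge0// => H.
by exists n.
Qed.

(* Neumann series *)
Lemma resolvent_bound_of lam g q :
  q < 1 -> N (1 - (a - iota lam) * g) <= q -> resolvent_bound lam (N g / (1 - q)).
Proof.
move=> q1 eq; set e := 1 - _ in eq.
have q0 : 0 <= q by apply: le_trans eq; exact: (seminorm_ge0 semiN).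
have q01 : 0 <= q < 1 by rewrite q0.
move=> eps e0; have [n qn] := geometric_small q01 e0.
exists (g * \sum_(i < n) e ^+ i); split.
  apply: seminormM_le => //.
  apply: (le_trans _ (geom_sum_le n q01)).
  by apply: (@seminorm_sum n (fun i => e ^+ i)) => i; exact: seminormX.
rewrite mulrA; have -> : (a - iota lam) * g = 1 - e by rewrite /e subKr.
rewrite -[1 - e]opprB mulNr -subrX1 opprK addrC subrK.
by apply: le_trans qn; exact: seminormX.
Qed.

(** The element [- lam^-1] inverts [a - lam] up to the defect [a / lam], whose norm is less than 1;
    the Neumann series does the rest. *)
Lemma resolvent_bound_far lam :
  N a < cmod lam -> resolvent_bound lam (cmod lam - N a)^-1.
Proof.
move=> al.
have l0 : 0 < cmod lam by apply: le_lt_trans al; exact: (seminorm_ge0 semiN).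
have lN0 : lam != 0 by apply: contraTneq l0 => ->; rewrite cmod0 ltxx.
pose q := N a / cmod lam.
have q1 : q < 1 by rewrite /q ltr_pdivrMr ?mul1r.
have ge : 1 - (a - iota lam) * iota (- lam^-1) = a * iota lam^-1.
  rewrite rmorphN mulrN opprK mulrBl -rmorphM divff// rmorph1 addrC subrK.
  by [].
have Hq : N (1 - (a - iota lam) * iota (- lam^-1)) <= q.
  rewrite ge; apply: seminormM_le => //.
  by rewrite (le_trans (seminorm_cst semiN _))// cmodV.
apply: resolvent_boundW (resolvent_bound_of q1 Hq).
have -> : (cmod lam - N a)^-1 = (cmod lam)^-1 / (1 - q).
  by rewrite /q -invfM mulrBr mulr1 mulrCA divff ?mulr1// gt_eqF.
rewrite ler_pM2r ?invr_gt0 ?subr_gt0//.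
by rewrite (le_trans (seminorm_cst semiN _))// cmodN cmodV.
Qed.

Lemma resolvent_bound_near lam g : N (1 - (a - iota lam) * g) < 1 ->
  exists b rho, 0 < rho /\ forall mu, cmod (mu - lam) < rho -> resolvent_bound mu b.
Proof.
set p := N _ => p1.
(* [q] is halfway between the defect [p] and 1; moving [lam] by less than [rho] costs at most the
   other half, [(1 - p) / 2]. *)
pose q := (1 + p) / 2; pose rho := (1 - p) / 2 / (N g + 1).
have g0 := seminorm_ge0 semiN g.
exists (N g / (1 - q)), rho; split; first by rewrite /rho; apply: divr_gt0; lra.
move=> mu mul; apply: resolvent_bound_of; first by rewrite /q; lra.
have -> : 1 - (a - iota mu) * g = (1 - (a - iota lam) * g) + iota (mu - lam) * g.
  by rewrite rmorphB; ring.
have -> : q = p + (1 - p) / 2 by rewrite /q; lra.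
apply: seminormD_le => //.
apply: (le_trans (seminormM_le (le_trans (seminorm_cst semiN _) (ltW mul)) (lexx _))).
by rewrite /rho mulrAC ler_pdivrMr; [apply: ler_wpM2l|]; lra.
Qed.

(* For [b = a - lam], the average [s] of the inverses of [b - w] over the four
   roots [w] of [w ^ 4 = r ^ 4] is [b ^ 3 / (b ^ 4 - r ^ 4)], so that
   [s - r ^ 4 b ^ (-4) s = b ^ (-1)]: the resolvent satisfies the mean value
   property up to an error of order [r ^ 4]. *)
Lemma resolvent_bound_submean lam (r B b1 b2 b3 b4 : R) : 0 <= r ->
  resolvent_bound lam B -> b1 <= B -> b2 <= B -> b3 <= B -> b4 <= B ->
  resolvent_bound (lam + r%:C%C) b1 -> resolvent_bound (lam - r%:C%C) b2 ->
  resolvent_bound (lam + 'i%C * r%:C%C) b3 -> resolvent_bound (lam - 'i%C * r%:C%C) b4 ->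
  resolvent_bound lam ((b1 + b2 + b3 + b4) / 4 + r ^+ 4 * B ^+ 5).
Proof.
move=> r0 HB b1B b2B b3B b4B H1 H2 H3 H4 eps e0.
pose beta := N (a - iota lam).
(* [P] bounds the cofactor [Pi w] in [b ^ 4 - w ^ 4 = (b - w) * Pi w]. [M] is the factor by which
   the common accuracy [d] of the five approximate inverses is magnified. *)
pose P := beta ^+ 3 + beta ^+ 2 * r + beta * r ^+ 2 + r ^+ 3.
have beta0 : 0 <= beta := seminorm_ge0 semiN _.
have B0 : 0 <= B.
  by have [g [gB _]] := HB 1 ltr01; exact: le_trans (seminorm_ge0 semiN _) gB.
pose T := 1 + beta * B + (beta * B) ^+ 2 + (beta * B) ^+ 3.
pose M := T * (1 + beta * B) + beta * B ^+ 4 * (4^-1 * (P + P + P + P)).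
have P0 : 0 <= P by rewrite /P !addr_ge0// ?mulr_ge0// ?exprn_ge0.
have M0 : 0 <= M.
  by rewrite /M /T !(addr_ge0, mulr_ge0, exprn_ge0).
have d0 : 0 < eps / (M + 1) by rewrite divr_gt0// ltr_wpDl.
have [g [gB ge]] := HB _ d0.
have [g1 [g1b g1e]] := H1 _ d0; have [g2 [g2b g2e]] := H2 _ d0.
have [g3 [g3b g3e]] := H3 _ d0; have [g4 [g4b g4e]] := H4 _ d0.
move: d0 ge g1e g2e g3e g4e; set d := eps / _ => d0.
rewrite !(rmorphD, rmorphN, rmorphM) !opprD !addrA ?opprK.
pose j := iota 'i%C; pose rr := iota r%:C%C; pose qq := iota (4^-1 : R)%:C%C.
rewrite -/j -/rr.
move: beta0; rewrite /beta; set b := a - iota lam => beta0.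
set e := 1 - b * g; set e1 := 1 - _ * g1; set e2 := 1 - _ * g2.
set e3 := 1 - _ * g3; set e4 := 1 - _ * g4 => ee ee1 ee2 ee3 ee4.
have j2 : j * j = - 1.
  rewrite /j -rmorphM; have -> : ('i * 'i)%C = -1 :> R[i] by rewrite -expr2 sqr_i.
  by rewrite rmorphN1.
have q4 : qq * 4 = 1.
  rewrite /qq -(rmorph_nat iota 4) -rmorphM -(rmorph_nat (real_complex R) 4) -rmorphM.
  by rewrite mulVf ?rmorph1// pnatr_eq0.
have Nq : N qq <= 4^-1.
  by rewrite (le_trans (seminorm_cst semiN _))// cmod_real ger0_norm.
have Nr : N rr <= r.
  by rewrite (le_trans (seminorm_cst semiN _))// cmod_real ger0_norm.
have Nj : N j <= 1 by rewrite (le_trans (seminorm_cst semiN _))// cmodi.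
have Njr : N (j * rr) <= r by rewrite -[leRHS]mul1r; exact: seminormM_le.
have Nb : N b <= beta by [].
pose s := qq * (g1 + g2 + g3 + g4).
pose Pi w := b ^+ 3 + b ^+ 2 * w + b * w ^+ 2 + w ^+ 3.
pose E := qq * (Pi rr * e1 + Pi (- rr) * e2 + Pi (j * rr) * e3 + Pi (- (j * rr)) * e4).
have NPi w : N w <= r -> N (Pi w) <= P.
  move=> wr; rewrite /Pi /P; repeat apply: seminormD_le.
  - exact: seminormX.
  - by apply: seminormM_le => //; exact: seminormX.
  - by apply: seminormM_le => //; exact: seminormX.
  - exact: seminormX.
have NN w : N w <= r -> N (- w) <= r by move=> ?; exact: le_trans (seminormN _) _.
have Ns : N s <= (b1 + b2 + b3 + b4) / 4.
  by rewrite /s [leRHS]mulrC; apply: seminormM_le => //; repeat apply: seminormD_le.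
have NsB : N s <= B by apply: (le_trans Ns); lra.
have NE : N E <= 4^-1 * (P + P + P + P) * d.
  have -> : 4^-1 * (P + P + P + P) * d = 4^-1 * (P * d + P * d + P * d + P * d) by ring.
  rewrite /E; apply: seminormM_le => //.
  apply: seminormD_le; [apply: seminormD_le; [apply: seminormD_le|]|];
    by apply: seminormM_le => //; apply: NPi; rewrite ?NN.
have HE : (b ^+ 4 - rr ^+ 4) * s = b ^+ 3 - E.
  have h w f : (b ^+ 4 - w ^+ 4) * f = Pi w - Pi w * (1 - (b - w) * f).
    by rewrite /Pi; ring.
  have h2 f : (b ^+ 4 - rr ^+ 4) * f = Pi (- rr) - Pi (- rr) * (1 - (b + rr) * f).
    by rewrite /Pi; ring.
  have j4 : j ^+ 4 = 1.
    have -> : j ^+ 4 = (j * j) * (j * j) by ring.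
    by rewrite j2; ring.
  have h3 f : (b ^+ 4 - rr ^+ 4) * f = Pi (j * rr) - Pi (j * rr) * (1 - (b - j * rr) * f).
    by rewrite -h exprMn j4 mul1r.
  have h4 f : (b ^+ 4 - rr ^+ 4) * f =
      Pi (- (j * rr)) - Pi (- (j * rr)) * (1 - (b + j * rr) * f).
    have := h (- (j * rr)) f; rewrite opprK => <-.
    have -> : (- (j * rr)) ^+ 4 = j ^+ 4 * rr ^+ 4 by ring.
    by rewrite j4 mul1r.
  have hs : Pi rr + Pi (- rr) + Pi (j * rr) + Pi (- (j * rr)) = 4 * b ^+ 3.
    have -> : Pi rr + Pi (- rr) + Pi (j * rr) + Pi (- (j * rr)) =
      4 * b ^+ 3 + 2 * b * rr ^+ 2 * (1 + j * j) by rewrite /Pi; ring.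
    by rewrite j2 subrr mulr0 addr0.
  rewrite /s mulrCA !mulrDr (h rr g1) (h2 g2) (h3 g3) (h4 g4) -/e1 -/e2 -/e3 -/e4.
  have -> : b ^+ 3 = qq * (4 * b ^+ 3) by rewrite mulrA q4 mul1r.
  by rewrite -hs /E; ring.
exists (s - rr ^+ 4 * g ^+ 4 * s); split.
  apply: seminormB_le => //.
  have -> : r ^+ 4 * B ^+ 5 = r ^+ 4 * B ^+ 4 * B by ring.
  by apply: seminormM_le => //; apply: seminormM_le; exact: seminormX.
(* [e * t = 1 - (b * g) ^+ 4], so the defect splits into a multiple of [e] and a multiple of [E],
   both small. *)
pose t := 1 + b * g + (b * g) ^+ 2 + (b * g) ^+ 3.
have -> : 1 - b * (s - rr ^+ 4 * g ^+ 4 * s) = e * (t * (1 - b * s)) + b * g ^+ 4 * E.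
  have -> : E = b ^+ 3 - (b ^+ 4 - rr ^+ 4) * s by rewrite HE opprB addrC subrK.
  by rewrite /e /t; ring.
have N1 := seminorm1.
apply: (@le_trans _ _ (d * (T * (1 + beta * B)) + beta * B ^+ 4 * (4^-1 * (P + P + P + P) * d))).
  apply: seminormD_le.
    apply: seminormM_le => //; apply: seminormM_le.
      rewrite /t /T; repeat apply: seminormD_le => //; first exact: seminormM_le.
        by apply: seminormX; exact: seminormM_le.
      by apply: seminormX; exact: seminormM_le.
    by apply: seminormB_le => //; exact: seminormM_le.
  by apply: seminormM_le => //; apply: seminormM_le => //; exact: seminormX.
have -> : d * (T * (1 + beta * B)) + beta * B ^+ 4 * (4^-1 * (P + P + P + P) * d) = d * M.
  by rewrite /M; ring.
by rewrite /d -mulrA ler_piMr ?(ltW e0)// ler_pdivrMl ?mulr1 ?lerDl ?ltr_wpDl.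
Qed.

Hypothesis N1 : 1 <= N 1.

(** Since [(a - lam) * g] is close to 1, [g] cannot be small. This keeps the resolvent norm at 0
    positive, the starting point of the contradiction. *)
Lemma resolvent_bound_lower lam b :
  resolvent_bound lam b -> 1 <= (N a + cmod lam) * b.
Proof.
move=> H; apply/ler_addgt0Pr => e e0; have [g [gb ge]] := H e e0.
apply: (le_trans N1).
have -> : 1 = (a - iota lam) * g + (1 - (a - iota lam) * g) by rewrite addrC subrK.
apply: seminormD_le => //; apply: seminormM_le => //.
by apply: seminormB_le => //; exact: seminorm_cst.
Qed.

Hypothesis inv : forall lam, exists g, N (1 - (a - iota lam) * g) < 1.

(** Local bounds become a single one by compactness; as bounds may be enlarged, [B] tending to
    infinity serves as the parameter of the covering. *)
Lemma resolvent_bound_square (S : R) : exists B,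
  forall lam, `|re lam| <= S -> `|im lam| <= S -> resolvent_bound lam B.
Proof.
have cK : compact (`[- S, S]%classic `*` `[- S, S]%classic).
  by apply: compact_setX; exact: segment_compact.
have /compact_near_coveringP/(_ R (nbhs +oo%R)
  (fun B (xy : R * R) => resolvent_bound (Complex xy.1 xy.2) B)) := cK.
case=> [xy _|B [_ HB]].
  have [g /resolvent_bound_near[b [rho [rho0 Hb]]]] := inv (Complex xy.1 xy.2).
  exists (ball xy (rho / 2), [set B | b < B]) => /=.
    split; first by apply: nbhsx_ballx; rewrite divr_gt0.
    by exists b; split; rewrite ?num_real.
  move=> [[x y] B] /= [[] bx bY bB]; apply: resolvent_boundW (ltW bB) _.
  apply: Hb; apply: (le_lt_trans (cmod_le_sum _)) => /=.
  move: bx bY; rewrite /ball /= ![`|xy.1 - _|]distrC ![`|xy.2 - _|]distrC.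
  by move=> h1 h2; rewrite [ltRHS]splitr; exact: ltrD.
exists (B + 1) => -[x y] /= xS yS.
have := HB (B + 1); rewrite ltrDl ltr01 => /(_ isT (x, y)); apply.
by split; rewrite /= in_itv /= -ler_norml.
Qed.

Lemma resolvent_bound_all : exists B, forall lam, resolvent_bound lam B.
Proof.
have [B HB] := resolvent_bound_square (N a + 1).
exists (Num.max B 1) => lam.
have [lamS|lamS] := leP (cmod lam) (N a + 1).
  apply: (@resolvent_boundW _ B); first by rewrite le_max lexx.
  by apply: HB; apply: le_trans lamS; [exact: Re_le_cmod|exact: Im_le_cmod].
have aS : N a < cmod lam by lra.
apply: (resolvent_boundW _ (resolvent_bound_far aS)).
rewrite le_max; apply/orP; right.
by rewrite invf_le1 ?subr_gt0//; lra.
Qed.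

Definition resolvent_norm lam := inf [set b | resolvent_bound lam b].

Lemma resolvent_bound_ge0 lam b : resolvent_bound lam b -> 0 <= b.
Proof.
by move=> /(_ 1 ltr01)[g [gb _]]; exact: le_trans (seminorm_ge0 semiN _) gb.
Qed.

Lemma resolvent_norm_le lam b : resolvent_bound lam b -> resolvent_norm lam <= b.
Proof.
move=> H; apply: ge_inf => //; exists 0 => c; exact: resolvent_bound_ge0.
Qed.

Lemma resolvent_norm_bound lam eps : 0 < eps ->
  resolvent_bound lam (resolvent_norm lam + eps).
Proof.
move=> e0; have [B HB] := resolvent_bound_all.
have hi : has_inf [set b | resolvent_bound lam b].
  by split; [exists B; exact: HB|exists 0 => c; exact: resolvent_bound_ge0].
have [b Hb bl] := inf_adherent e0 hi.
exact: resolvent_boundW (ltW bl) Hb.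
Qed.

Lemma resolvent_norm_ge0 lam : 0 <= resolvent_norm lam.
Proof.
by apply/ler_addgt0Pr => e e0; apply: resolvent_bound_ge0 (resolvent_norm_bound _ e0).
Qed.

(** The infimum need not be attained, so the four-point inequality is applied to
    [resolvent_norm + d]; the cap [d <= 1] makes [B + 1] a bound at all five points. *)
Lemma resolvent_norm_submean : exists2 C, 0 <= C & forall lam (r : R), 0 <= r ->
  resolvent_norm lam <= (resolvent_norm (lam + r%:C%C) + resolvent_norm (lam - r%:C%C) +
    resolvent_norm (lam + 'i%C * r%:C%C) + resolvent_norm (lam - 'i%C * r%:C%C)) / 4
    + r ^+ 4 * C.
Proof.
have [B HB] := resolvent_bound_all.
have B0 : 0 <= B := resolvent_bound_ge0 (HB 0).
exists ((B + 1) ^+ 5) => [|lam r r0]; first by rewrite exprn_ge0// addr_ge0.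
apply/ler_addgt0Pr => e e0; pose d := Num.min e 1.
have d0 : 0 < d by rewrite lt_min e0 ltr01.
have d1 : d <= 1 by rewrite ge_min lexx orbT.
have de : d <= e by rewrite ge_min lexx.
have hB mu : resolvent_norm mu + d <= B + 1 by apply: lerD => //; exact: resolvent_norm_le.
have HB1 : resolvent_bound lam (B + 1) by apply: resolvent_boundW (HB lam); lra.
have := resolvent_norm_le (resolvent_bound_submean r0 HB1 (hB _) (hB _) (hB _) (hB _)
  (resolvent_norm_bound _ d0) (resolvent_norm_bound _ d0)
  (resolvent_norm_bound _ d0) (resolvent_norm_bound _ d0)).
set w := r ^+ 4 * _; lra.
Qed.

(* [u] is [resolvent_norm] plus a small multiple of [|lam| ^ 2]; the maximum
   principle fails for it at an (almost) maximal point, although it is small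
   far away. *)
Lemma spectrum_nonempty_absurd : False.
Proof.
have [C C0 submean] := resolvent_norm_submean.
have a0 : 0 <= N a := seminorm_ge0 semiN a.
have N10 : 0 < N a + 1 by rewrite ltr_wpDl.
pose m := resolvent_norm 0.
have m0 : 0 < m.
  rewrite lt_def resolvent_norm_ge0 andbT; apply/eqP => mE.
  have e0 : 0 < (2 * (N a + 1))^-1 by rewrite invr_gt0 mulr_gt0.
  have := resolvent_bound_lower (resolvent_norm_bound 0 e0).
  rewrite -/m mE add0r cmod0 addr0 leNgt => /negP; apply.
  by rewrite ltr_pdivrMr ?mulr_gt0// mul1r; lra.
pose S := N a + 1 + 3 / m.
have m30 : 0 < 3 / m by rewrite divr_gt0.
have S0 : 0 < S by rewrite /S; lra.
pose k := m / (3 * S ^+ 2).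
have S20 : 0 < S ^+ 2 by rewrite exprn_gt0.
have k0 : 0 < k by rewrite divr_gt0 ?mulr_gt0.
have kS : k * S ^+ 2 = m / 3 by rewrite /k; field; rewrite gt_eqF.
pose r := Num.min 1 (k / (C + k)).
have Ck0 : 0 < C + k by rewrite ltr_wpDl.
have r0 : 0 < r by rewrite lt_min ltr01 divr_gt0.
have r1 : r <= 1 by rewrite ge_min lexx.
have rC : r ^+ 2 * C < k.
  apply: (@le_lt_trans _ _ (r * C)).
    by rewrite ler_wpM2r// expr2 ler_piMr// ltW.
  apply: (@lt_le_trans _ _ (r * (C + k))); first by rewrite ltr_pM2l// ltrDl.
  by rewrite -ler_pdivlMr// ge_min lexx orbT.
(* Averaging over the four points gains [k * r ^+ 2] from the quadratic term and loses at most
   [r ^+ 4 * C]; [gam] is the net gain, and the slack [d] in the supremum is at most [gam]. *)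
pose gam := r ^+ 2 * (k - r ^+ 2 * C).
have gam0 : 0 < gam by rewrite mulr_gt0 ?exprn_gt0// subr_gt0.
pose u lam := resolvent_norm lam + k * cmod lam ^+ 2.
have [B HB] := resolvent_bound_all.
pose V := [set u lam | lam in [set lam | cmod lam <= S]].
have hV : has_sup V.
  split.
    by exists (u 0), 0 => //; change (cmod (0 : R[i]) <= S); rewrite cmod0 ltW.
  exists (B + k * S ^+ 2) => _ [lam lamS <-]; apply: lerD; first exact: resolvent_norm_le.
  by rewrite ler_wpM2l ?(ltW k0)// ler_pXn2r ?nnegrE ?cmod_ge0// ltW.
have uV lam : cmod lam <= S -> u lam <= sup V.
  by move=> lamS; apply: ub_le_sup; [case: hV|exists lam].
have mV : m <= sup V.
  have -> : m = u 0 by rewrite /u cmod0 expr0n /= mulr0 addr0.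
  by apply: uV; rewrite cmod0 ltW.
pose d := Num.min gam (m / 3).
have d0 : 0 < d by rewrite lt_min gam0 divr_gt0.
have [_ [lam lamS <-] ulam] := sup_adherent d0 hV.
have lamS1 : cmod lam <= S - 1.
  rewrite leNgt; apply/negP => lamS1.
  have al : N a < cmod lam by rewrite /S in lamS1; lra.
  have h1 : resolvent_norm lam <= m / 3.
    apply: (le_trans (resolvent_norm_le (resolvent_bound_far al))).
    have -> : m / 3 = (3 / m)^-1 by rewrite invf_div.
    by rewrite lef_pV2 ?posrE ?subr_gt0//; rewrite /S in lamS1; lra.
  have h2 : k * cmod lam ^+ 2 <= m / 3.
    by rewrite -kS ler_wpM2l ?(ltW k0)// ler_pXn2r ?nnegrE ?cmod_ge0// ltW.
  have h3 : d <= m / 3 by rewrite ge_min lexx orbT.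
  by move: ulam; rewrite /u; lra.
have hr : cmod (r%:C%C : R[i]) = r by rewrite cmod_real ger0_norm// ltW.
have hir : cmod ('i%C * r%:C%C : R[i]) = r by rewrite cmodM cmodi mul1r hr.
have hS w : cmod w = r -> cmod (lam + w) <= S.
  by move=> wr; apply: (le_trans (cmodD _ _)); rewrite wr; lra.
have u1 := uV _ (hS _ hr).
have u2 := uV _ (hS (- r%:C%C) (etrans (cmodN _) hr)).
have u3 := uV _ (hS _ hir).
have u4 := uV _ (hS (- ('i%C * r%:C%C)) (etrans (cmodN _) hir)).
have hsum : cmod (lam + r%:C%C) ^+ 2 + cmod (lam - r%:C%C) ^+ 2 +
    cmod (lam + 'i%C * r%:C%C) ^+ 2 + cmod (lam - 'i%C * r%:C%C) ^+ 2 =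
    4 * (cmod lam ^+ 2 + r ^+ 2).
  by rewrite !cmod_sqr; case: (lam) => x y /=; ring.
have := submean lam r (ltW r0).
have hd : d <= gam by rewrite ge_min lexx.
have hg : gam = k * r ^+ 2 - r ^+ 4 * C by rewrite /gam; ring.
move: ulam u1 u2 u3 u4 hsum; rewrite /u.
set n1 := resolvent_norm (lam + _); set n2 := resolvent_norm (lam - _).
set n3 := resolvent_norm (lam + _); set n4 := resolvent_norm (lam - _).
set c1 := cmod _ ^+ 2; set c2 := cmod _ ^+ 2; set c3 := cmod _ ^+ 2.
set c4 := cmod _ ^+ 2; set c5 := cmod _ ^+ 2.
move=> ulam u1 u2 u3 u4 hsum.
have hk : k * c2 + k * c3 + k * c4 + k * c5 = 4 * (k * c1 + k * r ^+ 2).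
  by rewrite -!mulrDr hsum; ring.
move: hg; set w := r ^+ 4 * C; set v := k * r ^+ 2 in hk *; lra.
Qed.

End SpectrumNonempty.

(* In the completion of [A]: the spectrum of [a] is not empty. *)
Lemma spectrum_nonempty (R : realType) (A : comNzRingType) (iota : {rmorphism R[i] -> A})
    (N : A -> R) (a : A) : seminorm iota N -> 1 <= N 1 ->
  exists lam, forall g, 1 <= N (1 - (a - iota lam) * g).
Proof.
move=> sN N1; apply: contrapT => H.
apply: (@spectrum_nonempty_absurd _ _ iota N sN a N1) => lam.
apply: contrapT => Hl; apply: H; exists lam => g; rewrite leNgt; apply/negP => gl.
by apply: Hl; exists g.
Qed.

(** * Polynomial hulls in C^2 *)

Section QuotientSeminorm.
Variables (R : realType) (A : comNzRingType) (iota : {rmorphism R[i] -> A}).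
Implicit Types (N : A -> R) (q f h : A).

Definition quotient_seminorm N q f : R := inf [set N (f - q * h) | h in setT].

Variables (N : A -> R) (q : A).
Hypothesis semiN : seminorm iota N.
Let Nq := quotient_seminorm N q.

Let has_inf_quotient f : has_inf [set N (f - q * h) | h in setT].
Proof.
split; first by exists (N (f - q * 0)), 0.
by exists 0 => _ [h _ <-]; exact: seminorm_ge0 semiN _.
Qed.

Lemma quotient_seminorm_le f h : Nq f <= N (f - q * h).
Proof. by apply: ge_inf; [case: (has_inf_quotient f)|exists h]. Qed.

Lemma quotient_seminorm_le0 f : Nq f <= N f.
Proof. by rewrite -[in leRHS](subr0 f) -(mulr0 q) quotient_seminorm_le. Qed.

Lemma quotient_seminorm_ge f b : (forall h, b <= N (f - q * h)) -> b <= Nq f.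
Proof.
move=> H; apply: lb_le_inf; first by case: (has_inf_quotient f).
by move=> _ [h _ <-].
Qed.

Lemma quotient_seminorm_adherent f eps : 0 < eps -> exists h, N (f - q * h) <= Nq f + eps.
Proof.
move=> e0; have [_ [h _ <-] /ltW H] := inf_adherent e0 (has_inf_quotient f).
by exists h.
Qed.

Lemma quotient_seminorm_ideal h : Nq (q * h) <= 0.
Proof.
apply: (le_trans (quotient_seminorm_le _ h)).
by rewrite subrr -(rmorph0 iota) (le_trans (seminorm_cst semiN _))// cmod0.
Qed.

Lemma quotient_seminormP : seminorm iota Nq.
Proof.
have ge0 f : 0 <= Nq f by apply: quotient_seminorm_ge => h; exact: seminorm_ge0 semiN _.
split => // [f g|f g|c].
- apply/ler_addgt0Pr => e e0; have e20 : 0 < e / 2 by rewrite divr_gt0.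
  have [h Hh] := quotient_seminorm_adherent f e20.
  have [k Hk] := quotient_seminorm_adherent g e20.
  apply: (le_trans (quotient_seminorm_le _ (h + k))).
  have -> : f + g - q * (h + k) = (f - q * h) + (g - q * k) by ring.
  by apply: (le_trans (seminormD semiN _ _)); lra.
- apply/ler_addgt0Pr => e e0.
  have f0 := ge0 f; have g0 := ge0 g.
  pose d := Num.min 1 (e / (Nq f + Nq g + 1)).
  have s0 : 0 < Nq f + Nq g + 1 by lra.
  have d0 : 0 < d by rewrite lt_min ltr01 divr_gt0.
  have d1 : d <= 1 by rewrite ge_min lexx.
  have de : d * (Nq f + Nq g + 1) <= e by rewrite -ler_pdivlMr// ge_min lexx orbT.
  have [h Hh] := quotient_seminorm_adherent f d0.
  have [k Hk] := quotient_seminorm_adherent g d0.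
  apply: (le_trans (quotient_seminorm_le _ (f * k + h * g - q * h * k))).
  have -> : f * g - q * (f * k + h * g - q * h * k) = (f - q * h) * (g - q * k) by ring.
  apply: (le_trans (seminormM semiN _ _)).
  apply: (@le_trans _ _ ((Nq f + d) * (Nq g + d))).
    by apply: ler_pM => //; exact: seminorm_ge0 semiN _.
  by nra.
- exact: le_trans (quotient_seminorm_le0 _) (seminorm_cst semiN _).
Qed.

End QuotientSeminorm.

(** * The hull in C^2 and uniform limits of polynomials on it *)

Section PolynomialHull.
Variable R : realType.
Local Notation C := R[i].
Local Notation A := {poly {poly C}}.
Implicit Types (p x : C2 R) (P Q : A) (K : set (C2 R)).

(** The outer variable is w and the coefficients are polynomials in z. The spectral argument needs a
    commutative ring, which the coefficient families of [hpoly_eval] do not form by themselves. *)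
Definition pev p P : C := P.[p.2%:P].[p.1].

Definition pcst : {rmorphism C -> A} := (polyC \o polyC : {rmorphism C -> A}).

Lemma pevD p P Q : pev p (P + Q) = pev p P + pev p Q.
Proof. by rewrite /pev !hornerE. Qed.

Lemma pevN p P : pev p (- P) = - pev p P.
Proof. by rewrite /pev !hornerE. Qed.

Lemma pevB p P Q : pev p (P - Q) = pev p P - pev p Q.
Proof. by rewrite pevD pevN. Qed.

Lemma pevM p P Q : pev p (P * Q) = pev p P * pev p Q.
Proof. by rewrite /pev !hornerE. Qed.

Lemma pev_cst p c : pev p (pcst c) = c.
Proof. by rewrite /pev /= !hornerE. Qed.

Lemma pev1 p : pev p 1 = 1.
Proof. by rewrite -(rmorph1 pcst) pev_cst. Qed.

Lemma pev0 p : pev p 0 = 0.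
Proof. by rewrite -(rmorph0 pcst) pev_cst. Qed.

Lemma pevX p P n : pev p (P ^+ n) = pev p P ^+ n.
Proof. by elim: n => [|n IH]; rewrite ?expr0 ?pev1// !exprS pevM IH. Qed.

Lemma pev_sum p n (F : nat -> A) : pev p (\sum_(i < n) F i) = \sum_(i < n) pev p (F i).
Proof. by apply: (big_morph (pev p)) => [P Q|]; rewrite ?pevD ?pev0. Qed.

Lemma pev_w p : pev p 'X = p.2.
Proof. by rewrite /pev !hornerE. Qed.

Lemma pev_z p : pev p 'X%:P = p.1.
Proof. by rewrite /pev !hornerE. Qed.

Lemma pev_hpoly P : exists n c, forall p, pev p P = hpoly_eval n c p.
Proof.
pose n := maxn (size P) (\max_(k < size P) size (P`_k)%R).
have sn k : (size (P`_k)%R <= n)%N.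
  have [kP|kP] := ltnP k (size P); last by rewrite nth_default// size_poly0.
  by rewrite leq_max; apply/orP; right; exact: (leq_bigmax (Ordinal kP)).
exists n, (fun j k => P`_k`_j) => p; rewrite /pev /hpoly_eval exchange_big /=.
rewrite (horner_coef_wide _ (leq_maxl _ _ : (size P <= n)%N)) horner_sum.
apply: eq_bigr => k _; rewrite -rmorphXn hornerM hornerC.
rewrite (horner_coef_wide _ (sn k)) mulr_suml.
by apply: eq_bigr => j _.
Qed.

Lemma hpoly_pev n c : exists P, forall p, pev p P = hpoly_eval n c p.
Proof.
exists (\sum_(j < n) \sum_(k < n) pcst (c j k) * 'X%:P ^+ j * 'X ^+ k) => p.
rewrite (pev_sum p n (fun j => \sum_(k < n) pcst (c j k) * 'X%:P ^+ j * 'X ^+ k)).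
rewrite /hpoly_eval; apply: eq_bigr => j _.
rewrite (pev_sum p n (fun k => pcst (c j k) * 'X%:P ^+ j * 'X ^+ k)).
by apply: eq_bigr => k _; rewrite !pevM !pevX pev_cst pev_w pev_z.
Qed.

(** The maximal ideal of the point [p] is generated by [z - p.1] and [w - p.2]; hence a seminorm
    that kills this ideal sees only the value at [p]. *)
Lemma pev_factor p P : exists Q1 Q2,
  P - pcst (pev p P) = ('X%:P - pcst p.1) * Q1 + ('X - pcst p.2) * Q2.
Proof.
have /factor_theorem[Q2 E2] : root (P - P.[p.2%:P]%:P) p.2%:P.
  by rewrite rootE !hornerE subrr.
have /factor_theorem[Q1 E1] : root (P.[p.2%:P] - P.[p.2%:P].[p.1]%:P) p.1.
  by rewrite rootE !hornerE subrr.
exists Q1%:P, Q2.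
have -> : P - pcst (pev p P) = (P.[p.2%:P] - (pev p P)%:P)%:P + (P - P.[p.2%:P]%:P).
  by rewrite polyCB [RHS]addrC addrA subrK.
by rewrite E2 E1 polyCM polyCB; congr (_ + _); rewrite mulrC.
Qed.

Variables (K : set (C2 R)).
Hypothesis K0 : K !=set0.
Hypothesis Kb : forall P, exists B, forall k, K k -> cmod (pev k P) <= B.

(** [K0] and [Kb] ensure that this is a genuine supremum and not the default value of [sup]. *)
Definition sup_norm P : R := sup [set cmod (pev k P) | k in K].

Let has_sup_norm P : has_sup [set cmod (pev k P) | k in K].
Proof.
split; first by have [k Kk] := K0; exists (cmod (pev k P)), k.
by have [B HB] := Kb P; exists B => _ [k Kk <-]; exact: HB.
Qed.

Lemma sup_norm_ge P k : K k -> cmod (pev k P) <= sup_norm P.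
Proof. by move=> Kk; apply: ub_le_sup; [case: (has_sup_norm P)|exists k]. Qed.

Lemma sup_norm_le P B : (forall k, K k -> cmod (pev k P) <= B) -> sup_norm P <= B.
Proof.
by move=> H; apply: ge_sup; [case: (has_sup_norm P)|move=> _ [k Kk <-]; exact: H].
Qed.

Lemma poly_hullP p : poly_hull K p <-> forall P, cmod (pev p P) <= sup_norm P.
Proof.
split => [H P|H n c].
  have [n [c E]] := pev_hpoly P; rewrite E; apply: (le_trans (H n c)).
  by rewrite /sup_norm (eq_imagel (f' := fun k => cmod (hpoly_eval n c k)))// => k _; rewrite E.
have [P E] := hpoly_pev n c; rewrite -E; apply: (le_trans (H P)).
by rewrite /sup_norm (eq_imagel (f' := fun k => cmod (hpoly_eval n c k)))// => k _; rewrite E.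
Qed.

Lemma poly_hull_le p P B : poly_hull K p ->
  (forall k, K k -> cmod (pev k P) <= B) -> cmod (pev p P) <= B.
Proof. by move=> /poly_hullP H /sup_norm_le; exact: le_trans. Qed.

Lemma sub_poly_hull : K `<=` poly_hull K.
Proof. by move=> k Kk; apply/poly_hullP => P; exact: sup_norm_ge. Qed.

Lemma sup_norm_seminorm : seminorm pcst sup_norm.
Proof.
split => [P|P Q|P Q|c].
- have [k Kk] := K0; exact: le_trans (cmod_ge0 _) (sup_norm_ge P Kk).
- apply: sup_norm_le => k Kk; rewrite pevD (le_trans (cmodD _ _))//.
  by apply: lerD; exact: sup_norm_ge.
- apply: sup_norm_le => k Kk; rewrite pevM cmodM.
  by apply: ler_pM; rewrite ?cmod_ge0 ?sup_norm_ge.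
- by apply: sup_norm_le => k Kk; rewrite pev_cst.
Qed.

(* If [Q] generates a proper ideal, quotienting successively by [Q], [z - lam]
   and [w - mu] for spectral values [lam], [mu] yields a point of the hull
   at which [Q] vanishes. *)
Lemma inverse_mod_hull Q : (forall p, poly_hull K p -> pev p Q != 0) ->
  exists P, sup_norm (1 - Q * P) < 1.
Proof.
move=> Q0; apply: contrapT => H.
have H1 P : 1 <= sup_norm (1 - Q * P).
  by rewrite leNgt; apply/negP => ?; apply: H; exists P.
have s0 := sup_norm_seminorm.
pose N1 := quotient_seminorm sup_norm Q.
have s1 : seminorm pcst N1 := quotient_seminormP Q s0.
have N11 : 1 <= N1 1 := quotient_seminorm_ge s0 H1.
have [lam Hlam] := spectrum_nonempty 'X%:P s1 N11.
pose N2 := quotient_seminorm N1 ('X%:P - pcst lam).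
have s2 : seminorm pcst N2 := quotient_seminormP _ s1.
have N21 : 1 <= N2 1 := quotient_seminorm_ge s1 Hlam.
have [mu Hmu] := spectrum_nonempty 'X s2 N21.
pose N3 := quotient_seminorm N2 ('X - pcst mu).
have s3 : seminorm pcst N3 := quotient_seminormP _ s2.
have N31 : 1 <= N3 1 := quotient_seminorm_ge s2 Hmu.
pose p : C2 R := (lam, mu).
have N3N2 P : N3 P <= N2 P := quotient_seminorm_le0 _ s2 P.
have N2N1 P : N2 P <= N1 P := quotient_seminorm_le0 _ s1 P.
have N1N0 P : N1 P <= sup_norm P := quotient_seminorm_le0 _ s0 P.
(* Modulo the ideal killed by [N3], [P] is the constant [pev p P], and [1 <= N3 1] bounds the
   modulus of a constant by its seminorm. So evaluation at [p] is dominated by [sup_norm], which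
   puts [p] in the hull, and by [N1], which kills [Q]. *)
have pN3 P : cmod (pev p P) <= N3 P.
  have [->|c0] := eqVneq (pev p P) 0; first by rewrite cmod0 (seminorm_ge0 s3).
  set c := pev p P in c0 *.
  have h1 : cmod c <= N3 (pcst c).
    rewrite -[leLHS]mulr1 -ler_pdivlMl ?cmod_gt0//.
    apply: (le_trans N31).
    have -> : 1 = pcst c^-1 * pcst c by rewrite -rmorphM mulVf// rmorph1.
    apply: (le_trans (seminormM s3 _ _)).
    by rewrite ler_wpM2r ?(seminorm_ge0 s3)// -cmodV (seminorm_cst s3).
  apply: (le_trans h1).
  have [Q1 [Q2 E]] := pev_factor p P.
  have -> : pcst c = P - (P - pcst c) by rewrite subKr.
  apply: (le_trans (seminormB s3 _ _)); rewrite gerDl E.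
  apply: (le_trans (seminormD s3 _ _)).
  have -> : 0 = 0 + 0 :> R by rewrite addr0.
  apply: lerD; last exact: quotient_seminorm_ideal s2 _.
  by apply: (le_trans (N3N2 _)); exact: quotient_seminorm_ideal s1 _.
have Hp : poly_hull K p.
  apply/poly_hullP => P; apply: (le_trans (pN3 P)).
  exact: le_trans (N3N2 _) (le_trans (N2N1 _) (N1N0 _)).
have := Q0 p Hp; rewrite -{1}(cmod_eq0 (x := pev p Q)) ?eqxx//.
apply/eqP; rewrite eq_le cmod_ge0 andbT.
apply: (le_trans (pN3 Q)); apply: (le_trans (N3N2 _)); apply: (le_trans (N2N1 _)).
by rewrite -[Q]mulr1; exact: quotient_seminorm_ideal s0 _.
Qed.

Definition hull_approx (f : C2 R -> C) := forall eps, 0 < eps ->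
  exists P, forall x, poly_hull K x -> cmod (f x - pev x P) <= eps.

Lemma hull_approx_pev P : hull_approx (fun x => pev x P).
Proof. by move=> e e0; exists P => x _; rewrite subrr cmod0 ltW. Qed.

Lemma hull_approx_bounded f : hull_approx f ->
  exists2 B, 0 <= B & forall x, poly_hull K x -> cmod (f x) <= B.
Proof.
move=> /(_ 1 ltr01)[P HP]; have [B HB] := Kb P.
exists (1 + Num.max B 0) => [|x Hx]; first by rewrite addr_ge0// le_max lexx orbT.
rewrite -[f x](subrK (pev x P)); apply: (le_trans (cmodD _ _)).
by apply: lerD; rewrite ?HP// le_max (poly_hull_le Hx HB).
Qed.

Lemma hull_approxM f g : hull_approx f -> hull_approx g ->
  hull_approx (fun x => f x * g x).
Proof.
move=> Hf Hg e e0.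
have [Bf Bf0 HBf] := hull_approx_bounded Hf.
have [Bg Bg0 HBg] := hull_approx_bounded Hg.
pose d := Num.min 1 (e / (Bf + Bg + 1)).
have s0 : 0 < Bf + Bg + 1 by lra.
have d0 : 0 < d by rewrite lt_min ltr01 divr_gt0.
have d1 : d <= 1 by rewrite ge_min lexx.
have de : d * (Bf + Bg + 1) <= e by rewrite -ler_pdivlMr// ge_min lexx orbT.
have [P HP] := Hf d d0; have [Q HQ] := Hg d d0.
exists (P * Q) => x Hx; rewrite pevM.
have -> : f x * g x - pev x P * pev x Q =
  f x * (g x - pev x Q) + (f x - pev x P) * (g x - (g x - pev x Q)) by ring.
apply: (le_trans (cmodD _ _)); rewrite !cmodM.
apply: (@le_trans _ _ (Bf * d + d * (Bg + d))); last by nra.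
apply: lerD; apply: ler_pM; rewrite ?cmod_ge0 ?HBf ?HQ ?HP//.
by apply: (le_trans (cmodD _ _)); rewrite cmodN; apply: lerD; rewrite ?HBg ?HQ.
Qed.

Lemma hull_approx_le f B p : hull_approx f -> poly_hull K p ->
  (forall k, K k -> cmod (f k) <= B) -> cmod (f p) <= B.
Proof.
move=> Hf Hp HB; apply/ler_addgt0Pr => e e0.
have e20 : 0 < e / 2 by rewrite divr_gt0.
have [P HP] := Hf _ e20.
have hP : cmod (pev p P) <= B + e / 2.
  apply: (poly_hull_le Hp) => k Kk.
  have -> : pev k P = f k - (f k - pev k P) by rewrite subKr.
  apply: (le_trans (cmodD _ _)); rewrite cmodN; apply: lerD; first exact: HB.
  by apply: HP; exact: sub_poly_hull.
rewrite -[f p](subrK (pev p P)); apply: (le_trans (cmodD _ _)).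
by have := HP p Hp; lra.
Qed.

(** With [c = 1 - Q * h] of modulus at most [q < 1] on the hull, the partial sums of [h / (1 - c)]
    differ from [1 / Q] by [c ^ n / Q], and [1 / Q] is bounded by [B / (1 - q)]. *)
Lemma hull_approxV Q : (forall p, poly_hull K p -> pev p Q != 0) ->
  hull_approx (fun x => (pev x Q)^-1).
Proof.
move=> Q0 e e0; have [h Hh] := inverse_mod_hull Q0.
set q := sup_norm _ in Hh.
have q0 : 0 <= q by exact: seminorm_ge0 sup_norm_seminorm _.
have q01 : 0 <= q < 1 by rewrite q0.
have [B B0 HB] := hull_approx_bounded (hull_approx_pev h).
have s0 : 0 < B + 1 by rewrite ltr_wpDl.
have d0 : 0 < e * (1 - q) / (B + 1) by rewrite divr_gt0// mulr_gt0// subr_gt0.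
have [n qn] := geometric_small q01 d0.
exists (h * \sum_(i < n) (1 - Q * h) ^+ i) => x Hx.
rewrite pevM (pev_sum x n (fun i => (1 - Q * h) ^+ i)).
under eq_bigr do rewrite pevX.
set c := pev x (1 - Q * h); set b := pev x Q; set g := pev x h.
have bg : b * g = 1 - c by rewrite /c pevB pev1 pevM subKr.
have cq : cmod c <= q by apply: (poly_hull_le Hx) => k Kk; exact: sup_norm_ge.
have b0 : b != 0 := Q0 x Hx.
have -> : b^-1 - g * (\sum_(i < n) c ^+ i) = b^-1 * c ^+ n.
  apply: (mulfI b0); rewrite mulrBr mulfV// !mulrA mulfV// mul1r bg.
  by rewrite -[1 - c]opprB mulNr -subrX1 opprB subKr.
have Vb : cmod b^-1 <= B / (1 - q).
  rewrite ler_pdivlMr ?subr_gt0//.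
  apply: (@le_trans _ _ (cmod b^-1 * cmod (b * g))).
    apply: ler_wpM2l; first exact: cmod_ge0.
    rewrite bg; have := cmodD (1 - c) c; rewrite subrK cmod1; lra.
  by rewrite -cmodM mulrA mulVf// mul1r; exact: HB.
rewrite cmodM cmodX.
apply: (@le_trans _ _ (B / (1 - q) * (e * (1 - q) / (B + 1)))).
  apply: ler_pM => //; [exact: cmod_ge0|by rewrite exprn_ge0 ?cmod_ge0|].
  by apply: le_trans qn; rewrite lerXn2r ?nnegrE ?cmod_ge0.
have -> : B / (1 - q) * (e * (1 - q) / (B + 1)) = e * (B / (B + 1)).
  by field; rewrite !gt_eqF// subr_gt0.
by rewrite ler_piMr ?(ltW e0)// ler_pdivrMr// mul1r lerDl.
Qed.

End PolynomialHull.

Section ComplexContinuity.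
Variables (R : realType) (T : topologicalType).
Implicit Types f g : T -> R[i].

Definition ccontinuous f :=
  continuous (fun x => re (f x)) /\ continuous (fun x => im (f x)).

Lemma ccontinuous_cst (c : R[i]) : ccontinuous (fun=> c).
Proof. by split => x; exact: cvg_cst. Qed.

Lemma ccontinuousD f g : ccontinuous f -> ccontinuous g ->
  ccontinuous (fun x => f x + g x).
Proof.
move=> [f1 f2] [g1 g2]; split => x.
- have -> : (fun x => re (f x + g x)) = (fun x => re (f x) + re (g x)).
    by apply/funext => y; case: (f y) => ? ?; case: (g y).
  by apply: cvgD; [exact: f1|exact: g1].
- have -> : (fun x => im (f x + g x)) = (fun x => im (f x) + im (g x)).
    by apply/funext => y; case: (f y) => ? ?; case: (g y).
  by apply: cvgD; [exact: f2|exact: g2].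
Qed.

Lemma ccontinuousM f g : ccontinuous f -> ccontinuous g ->
  ccontinuous (fun x => f x * g x).
Proof.
move=> [f1 f2] [g1 g2]; split => x.
- have -> : (fun x => re (f x * g x)) =
    (fun x => re (f x) * re (g x) - im (f x) * im (g x)).
    by apply/funext => y; case: (f y) => ? ?; case: (g y).
  by apply: cvgB; apply: cvgM; by [exact: f1|exact: g1|exact: f2|exact: g2].
- have -> : (fun x => im (f x * g x)) =
    (fun x => re (f x) * im (g x) + im (f x) * re (g x)).
    by apply/funext => y; case: (f y) => ? ?; case: (g y).
  by apply: cvgD; apply: cvgM; by [exact: f1|exact: g1|exact: f2|exact: g2].
Qed.

Lemma ccontinuousB f g : ccontinuous f -> ccontinuous g ->
  ccontinuous (fun x => f x - g x).
Proof.
move=> fc gc; have -> : (fun x => f x - g x) = (fun x => f x + (-1) * g x).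
  by apply/funext => x; rewrite mulN1r.
by apply: ccontinuousD => //; apply: ccontinuousM => //; exact: ccontinuous_cst.
Qed.

Lemma ccontinuousX f n : ccontinuous f -> ccontinuous (fun x => f x ^+ n).
Proof.
move=> fc; elim: n => [|n IH]; first exact: ccontinuous_cst.
have -> : (fun x => f x ^+ n.+1) = (fun x => f x * f x ^+ n).
  by apply/funext => x; rewrite exprS.
exact: ccontinuousM.
Qed.

Lemma ccontinuous_sum n (F : nat -> T -> R[i]) : (forall i, ccontinuous (F i)) ->
  ccontinuous (fun x => \sum_(i < n) F i x).
Proof.
move=> Fc; elim: n => [|n IH].
  have -> : (fun x => \sum_(i < 0) F i x) = (fun=> 0).
    by apply/funext => x; rewrite big_ord0.
  exact: ccontinuous_cst.
have -> : (fun x => \sum_(i < n.+1) F i x) = (fun x => \sum_(i < n) F i x + F n x).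
  by apply/funext => x; rewrite big_ord_recr.
exact: ccontinuousD.
Qed.

Lemma ccontinuous_horner (Q : {poly R[i]}) f : ccontinuous f ->
  ccontinuous (fun x => Q.[f x]).
Proof.
move=> fc; have -> : (fun x => Q.[f x]) = (fun x => \sum_(i < size Q) Q`_i * f x ^+ i).
  by apply/funext => x; rewrite horner_coef.
apply: (@ccontinuous_sum _ (fun i x => Q`_i * f x ^+ i)) => i.
by apply: ccontinuousM; [exact: ccontinuous_cst|exact: ccontinuousX].
Qed.

Lemma ccontinuous_pev (P : {poly {poly R[i]}}) (k : T -> C2 R) :
  ccontinuous (fun x => (k x).1) -> ccontinuous (fun x => (k x).2) ->
  ccontinuous (fun x => pev (k x) P).
Proof.
move=> k1 k2; have [n [c E]] := pev_hpoly P.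
have -> : (fun x => pev (k x) P) = (fun x => hpoly_eval n c (k x)).
  by apply/funext => x; rewrite E.
apply: (@ccontinuous_sum _ (fun i x => \sum_(j < n) c i j * (k x).1 ^+ i * (k x).2 ^+ j)) => i.
apply: (@ccontinuous_sum _ (fun j x => c i j * (k x).1 ^+ i * (k x).2 ^+ j)) => j.
apply: ccontinuousM; last exact: ccontinuousX.
by apply: ccontinuousM; [exact: ccontinuous_cst|exact: ccontinuousX].
Qed.

Lemma continuous_cmod f : ccontinuous f -> continuous (fun x => cmod (f x)).
Proof.
move=> [f1 f2] x.
have -> : (fun x => cmod (f x)) = Num.sqrt \o (fun x => re (f x) * re (f x) + im (f x) * im (f x)).
  by apply/funext => y /=; case: (f y) => a b; rewrite /= !expr2.
apply: continuous_comp; last exact: sqrt_continuous.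
by apply: cvgD; apply: cvgM; by [exact: f1|exact: f2].
Qed.

End ComplexContinuity.

Lemma continuous_on_bounded (R : realType) (T : topologicalType) (D : set T) (f : T -> R) :
  compact D -> {within D, continuous f} -> exists B, forall x, D x -> f x <= B.
Proof.
move=> cD fc; have [->|/set0P D0] := eqVneq D set0; first by exists 0.
have [c _ H] := compact_EVT_max D0 cD fc.
by exists (f c) => x Dx; apply: H; rewrite inE.
Qed.

Lemma compact_superlevel (R : realType) (T : topologicalType) (D : set T) (f : T -> R) b :
  compact D -> {within D, continuous f} -> compact (D `&` [set x | b <= f x]).
Proof.
move=> cD fc.
have /closed_subspaceP[V cV E] : closed ([set x | b <= f x] : set (subspace D)).
  by apply: (@closed_comp _ _ (f : subspace D -> R) [set y | b <= y]);
    [move=> x _; exact: fc|exact: closed_ge].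
by rewrite setIC -E setIC; exact: compact_closedI.
Qed.

(** * Fibers of z / w on the hull *)

Section HullFiber.
Variables (R : realType) (T : topologicalType) (D : set T) (k : T -> C2 R).
Hypotheses (D0 : D !=set0) (cD : compact D).
Hypotheses (k1 : ccontinuous (fun x : subspace D => (k x).1))
           (k2 : ccontinuous (fun x : subspace D => (k x).2)).
Let K := k @` D.
Hypothesis KM : K `<=` @Mcone R.
Hypothesis Kaxes : poly_hull K `&` @axes R = set0.

Let K0 : K !=set0.
Proof. by have [x Dx] := D0; exists (k x), x. Qed.

Let Kb P : exists B, forall y, K y -> cmod (pev y P) <= B.
Proof.
have [B HB] := continuous_on_bounded cD (continuous_cmod (ccontinuous_pev P k1 k2)).
by exists B => _ [x Dx <-]; exact: HB.
Qed.

Let hull_neq0 p : poly_hull K p -> p.1 != 0 /\ p.2 != 0.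
Proof.
move=> Hp; have : ~ axes p by move=> Ap; have : (set0 : set (C2 R)) p by rewrite -Kaxes.
by rewrite /axes /= => /eqP; rewrite mulf_eq0 negb_or => /andP[].
Qed.

Let approx1 : hull_approx K (fun x => x.1).
Proof.
have -> : (fun x : C2 R => x.1) = (fun x => pev x 'X%:P) by apply/funext => x; rewrite pev_z.
exact: hull_approx_pev.
Qed.

Let approx2 : hull_approx K (fun x => x.2).
Proof.
have -> : (fun x : C2 R => x.2) = (fun x => pev x 'X) by apply/funext => x; rewrite pev_w.
exact: hull_approx_pev.
Qed.

Let approxV1 : hull_approx K (fun x => x.1^-1).
Proof.
have -> : (fun x : C2 R => x.1^-1) = (fun x => (pev x 'X%:P)^-1).
  by apply/funext => x; rewrite pev_z.
by apply: (hull_approxV K0 Kb) => p /hull_neq0[]; rewrite pev_z.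
Qed.

Let approxV2 : hull_approx K (fun x => x.2^-1).
Proof.
have -> : (fun x : C2 R => x.2^-1) = (fun x => (pev x 'X)^-1).
  by apply/funext => x; rewrite pev_w.
by apply: (hull_approxV K0 Kb) => p /hull_neq0[]; rewrite pev_w.
Qed.

Lemma Mcone_neq0 (p : C2 R) : Mcone p -> p.1 != 0 /\ p.2 != 0.
Proof.
case: p => z w [/= E ne]; split; apply/eqP => H; apply: ne; move: E; rewrite H cmod0.
  by move=> /esym/cmod_eq0 ->.
by move=> /cmod_eq0 ->.
Qed.

Lemma hull_cmod_le p : poly_hull K p -> cmod p.1 = cmod p.2.
Proof.
move=> Hp; have [p1 p2] := hull_neq0 Hp.
have h1 : cmod (p.1 * p.2^-1) <= 1.
  apply: (hull_approx_le K0 Kb (hull_approxM K0 Kb approx1 approxV2) Hp) => y Ky.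
  have [E _] := KM Ky; have [_ y2] := Mcone_neq0 (KM Ky).
  by rewrite cmodM cmodV E divff// gt_eqF// cmod_gt0.
have h2 : cmod (p.2 * p.1^-1) <= 1.
  apply: (hull_approx_le K0 Kb (hull_approxM K0 Kb approx2 approxV1) Hp) => y Ky.
  have [E _] := KM Ky; have [y1 _] := Mcone_neq0 (KM Ky).
  by rewrite cmodM cmodV -E divff// gt_eqF// cmod_gt0.
apply/eqP; rewrite eq_le; apply/andP; split.
  by move: h1; rewrite cmodM cmodV ler_pdivrMr ?mul1r ?cmod_gt0.
by move: h2; rewrite cmodM cmodV ler_pdivrMr ?mul1r ?cmod_gt0.
Qed.

(** By the parallelogram law the gap is [|a - b| ^ 2]. *)
Lemma cmod_addr_le (a b : R[i]) : cmod a = cmod b -> a != b ->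
  cmod (a + b) ^+ 2 < 4 * cmod b ^+ 2.
Proof.
move=> E ne; have := cmod_sqr a; have := cmod_sqr b; rewrite E.
have : 0 < cmod (a - b) ^+ 2 by rewrite exprn_gt0// cmod_gt0// subr_eq0.
rewrite !(cmod_sqr (_ + _)); move: a b {E ne} => [a1 a2] [b1 b2] /=; nra.
Qed.

(* The function [(1 + c z / w) / 2] with [c = w_p / z_p] peaks on the fiber of
   [z / w] through [p]. *)
Lemma hull_fiber p (Q : {poly R[i]}) B : poly_hull K p -> 0 <= B ->
  (forall x, D x -> (k x).1 * p.2 = (k x).2 * p.1 -> cmod Q.[(k x).2] <= B) ->
  cmod Q.[p.2] <= B.
Proof.
move=> Hp B0 HB; have [p1 p2] := hull_neq0 Hp.
have Ep := hull_cmod_le Hp.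
pose q x := cmod Q.[(k x).2].
have qc : {within D, continuous q} by apply: continuous_cmod; exact: ccontinuous_horner.
have [W HW] := continuous_on_bounded cD (continuous_cmod k2).
have [G HG] := continuous_on_bounded cD qc.
rewrite leNgt; apply/negP => Bm; set m := cmod Q.[p.2] in Bm.
(* On [D'], which avoids the fiber, [zeta] is bounded by some [r < 1]; elsewhere [|Q| < B'] and
   [|zeta| <= 1]. For large [n] the product [zeta ^ n * Q] is thus at most [B'] on [K], although its
   modulus at [p] is [m > B']. *)
pose B' := (B + m) / 2.
pose D' := D `&` [set x | B' <= q x].
pose c := p.2 / p.1.
have c1 : cmod c = 1 by rewrite /c cmodM cmodV Ep divff// gt_eqF// cmod_gt0.
pose zeta (x : C2 R) := (2^-1)%:C%C * (c * x.1 + x.2) * x.2^-1.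
have zE (y : C2 R) : cmod (zeta y) = cmod (c * y.1 + y.2) / (2 * cmod y.2).
  by rewrite /zeta !cmodM cmodV cmod_real ger0_norm ?invr_ge0// invfM; ring.
have zle1 x : D x -> cmod (zeta (k x)) <= 1.
  move=> Dx; have KMx : Mcone (k x) by apply: KM; exists x.
  have [x1 x2] := Mcone_neq0 KMx; have x20 := cmod_gt0 x2.
  rewrite zE// ler_pdivrMr ?mulr_gt0// mul1r; apply: (le_trans (cmodD _ _)).
  by rewrite cmodM c1 KMx.1; lra.
have [r /andP[r0 r1] Hr] : exists2 r, 0 <= r < 1 & forall x, D' x -> cmod (zeta (k x)) <= r.
  have [D'0|/set0P D'0] := eqVneq D' set0.
    by exists 0; [rewrite lexx ltr01|move=> x; rewrite D'0].
  have cD' : compact D' by exact: compact_superlevel.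
  (* [|zeta| ^ 2 = 1 - g / (4 * |w| ^ 2)], so [r] comes from the minimum of [g] on [D'] and the
     bound [W] for [|w|]. *)
  pose g x := 4 * cmod (k x).2 ^+ 2 - cmod (c * (k x).1 + (k x).2) ^+ 2.
  have gc : {within D, continuous g}.
    move=> x; apply: cvgB.
      apply: cvgM; first exact: cvg_cst.
      by apply: cvgM; exact: (continuous_cmod k2).
    have h : ccontinuous (fun x : subspace D => c * (k x).1 + (k x).2).
      by apply: ccontinuousD => //; apply: ccontinuousM => //; exact: ccontinuous_cst.
    by apply: cvgM; exact: (continuous_cmod h).
  have [x0 x0D' Hx0] := compact_EVT_min D'0 cD'
    (continuous_subspaceW (fun x (h : D' x) => h.1) gc).
  have {x0D'}[Dx0 qx0] : D' x0 by rewrite inE in x0D'.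
  have KMx0 : Mcone (k x0) by apply: KM; exists x0.
  have [x01 x02] := Mcone_neq0 KMx0.
  have g0 : 0 < g x0.
    rewrite subr_gt0; apply: cmod_addr_le; first by rewrite cmodM c1 mul1r KMx0.1.
    apply/eqP => H; have : q x0 <= B.
      apply: HB => //; rewrite -H /c; field.
      exact: p1.
    by apply/negP; rewrite -ltNge; apply: lt_le_trans qx0; rewrite /B'; lra.
  have W0 : 0 < W by apply: lt_le_trans (HW _ Dx0); exact: cmod_gt0.
  have s0 : 0 < 4 * W ^+ 2 by rewrite mulr_gt0 ?exprn_gt0.
  pose r2 := Num.max 0 (1 - g x0 / (4 * W ^+ 2)).
  have r20 : 0 <= r2 by rewrite le_max lexx.
  have r21 : r2 < 1 by rewrite gt_max ltr01 gtrBl divr_gt0.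
  exists (Num.sqrt r2).
    by rewrite sqrtr_ge0 -sqrtr1 ltr_sqrt.
  move=> x D'x; have [Dx qx] := D'x.
  have KMx : Mcone (k x) by apply: KM; exists x.
  have [x1 x2] := Mcone_neq0 KMx; have x20 := cmod_gt0 x2.
  rewrite -[leLHS]ger0_norm ?cmod_ge0// -sqrtr_sqr ler_sqrt//.
  rewrite zE// expr_div_n le_max; apply/orP; right.
  have gx : g x0 <= g x by apply: Hx0; rewrite inE.
  rewrite ler_pdivrMr ?exprn_gt0 ?mulr_gt0// exprMn mulrBl mul1r.
  have xW : cmod (k x).2 ^+ 2 <= W ^+ 2 by rewrite ler_pXn2r ?nnegrE ?cmod_ge0 ?(ltW W0)// HW.
  have : g x0 / (4 * W ^+ 2) * (2 ^+ 2 * cmod (k x).2 ^+ 2) <= g x0.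
    rewrite -mulrA ler_piMr ?(ltW g0)// ler_pdivrMl// mulr1.
    by have := xW; set u := cmod _ ^+ 2; set v := W ^+ 2; lra.
  by move: gx; rewrite /g; set u := cmod (_ * _ + _) ^+ 2; set v := g _ / _ * _; lra.
have G0 : 0 <= G.
  by have [x Dx] := D0; apply: le_trans (HG _ Dx); exact: cmod_ge0.
have B'0 : 0 < B' by rewrite /B'; lra.
have d0 : 0 < B' / (G + 1) by rewrite divr_gt0// ltr_wpDl.
have r01 : 0 <= r < 1 by rewrite r0.
have [n rn] := geometric_small r01 d0.
pose P := pcst R (2^-1)%:C%C * (pcst R c * 'X%:P + 'X).
have zP x : zeta x = pev x P * x.2^-1.
  by rewrite /P pevM pevD pevM !pev_cst pev_z pev_w.
have approx_zeta : hull_approx K zeta.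
  rewrite (_ : zeta = fun x => pev x P * x.2^-1); last by apply/funext => x.
  by apply: (hull_approxM K0 Kb) => //; exact: hull_approx_pev.
have approx_zetan : hull_approx K (fun x => zeta x ^+ n).
  elim: (n) => [|l IH].
    rewrite (_ : (fun x => _) = fun x => pev x 1); last by apply/funext => x; rewrite pev1.
    exact: hull_approx_pev.
  rewrite (_ : (fun x => _) = fun x => zeta x * zeta x ^+ l).
    exact: (hull_approxM K0 Kb).
  by apply/funext => x; rewrite exprS.
have approxQ : hull_approx K (fun x => Q.[x.2]).
  rewrite (_ : (fun x => _) = fun x : C2 R => pev x (map_poly polyC Q)).
    exact: hull_approx_pev.
  by apply/funext => x; rewrite /pev horner_map hornerC.
have zp : zeta p = 1.
  have h2 : (2^-1)%:C%C * 2 = 1 :> R[i].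
    by rewrite -(rmorph_nat (real_complex R) 2) -rmorphM mulVf ?rmorph1// pnatr_eq0.
  rewrite /zeta /c divfK//; have -> : p.2 + p.2 = 2 * p.2 by ring.
  by rewrite mulrA h2 mul1r divff.
have := hull_approx_le K0 Kb (hull_approxM K0 Kb approx_zetan approxQ) Hp (B := B').
rewrite zp expr1n mul1r -/m => H.
suff : m <= B' by rewrite /B'; lra.
apply: H => _ [x Dx <-]; rewrite cmodM cmodX -/(q x).
have z0 := cmod_ge0 (zeta (k x)).
have [qx|qx] := leP B' (q x).
  have zr : cmod (zeta (k x)) <= r by apply: Hr.
  apply: (@le_trans _ _ (B' / (G + 1) * (G + 1))); last by rewrite divfK// gt_eqF// ltr_wpDl.
  apply: ler_pM; rewrite ?exprn_ge0 ?cmod_ge0//.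
    by apply: le_trans rn; rewrite lerXn2r ?nnegrE.
  by apply: (le_trans (HG _ Dx)); rewrite lerDl.
rewrite -[leRHS]mul1r; apply: ler_pM; rewrite ?exprn_ge0 ?cmod_ge0 ?(ltW qx)//.
by rewrite exprn_ile1// zle1.
Qed.

End HullFiber.

(** * Continuous arguments on planar sets *)

Section Polar.
Variable R : realType.
Implicit Types (f g a b x : R) (k : int).

Definition polar f g a := exists2 r : R, 0 < r & f = r * cos a /\ g = r * sin a.

Lemma cos_sinD2piz x k : cos (x + k%:~R * (pi *+ 2)) = cos x /\
  sin (x + k%:~R * (pi *+ 2)) = sin x.
Proof.
have H n (y : R) : cos (y + n%:R * (pi *+ 2)) = cos y /\ sin (y + n%:R * (pi *+ 2)) = sin y.
  by rewrite mulr_natl (periodicn (@cosD2pi R)) (periodicn (@sinD2pi R)).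
case: k => n; first exact: H.
rewrite NegzE mulrNz mulNr.
have [h1 h2] := H n.+1 (x - n.+1%:R * (pi *+ 2)).
by rewrite subrK in h1 h2; rewrite h1 h2.
Qed.

Lemma cos_eq1 x : cos x = 1 -> exists k, x = k%:~R * (pi *+ 2).
Proof.
move=> cx; have p0 : 0 < (pi : R) *+ 2 by rewrite pmulrn_lgt0// pi_gt0.
pose k := Num.floor (x / (pi *+ 2)).
pose y := x - k%:~R * (pi *+ 2).
exists k; apply/eqP; rewrite -subr_eq0 -/y; apply/eqP.
have cy : cos y = 1.
  by rewrite -cx -(proj1 (cos_sinD2piz y k)) /y subrK.
have y0 : 0 <= y by rewrite subr_ge0 -ler_pdivlMr// ge_floor.
have y2 : y < pi *+ 2.
  rewrite ltrBlDr -[ltLHS](divfK (lt0r_neq0 p0)) -[X in _ < X + _]mul1r -mulrDl.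
  rewrite ltr_pM2r// addrC; have := lt_succ_floor (x / (pi *+ 2)).
  by rewrite intrD.
have H (z : R) : 0 <= z <= pi -> cos z = 1 -> z = 0.
  move=> z01 cz; apply: (@cos_inj R); rewrite ?in_itv/= ?lexx ?pi_ge0//.
  by rewrite cos0.
have [yp|yp] := leP y pi; first by apply: H => //; rewrite y0.
have : pi *+ 2 - y = 0.
  apply: H; first by rewrite mulr2n; apply/andP; split; rewrite mulr2n in y2; lra.
  by rewrite cosB cos2pi sin2pi mul1r mul0r addr0.
by move/eqP; rewrite subr_eq0 => /eqP E; rewrite E ltxx in y2.
Qed.

Lemma polarM f g a f' g' b : polar f g a -> polar f' g' b ->
  polar (f * f' - g * g') (f * g' + g * f') (a + b).
Proof.
move=> [r r0 [-> ->]] [s s0 [-> ->]]; exists (r * s); first exact: mulr_gt0.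
by rewrite cosD sinD; split; ring.
Qed.

Lemma polar_opp f g a : polar f g a -> polar (- f) (- g) (a + pi).
Proof. by move=> [r r0 [-> ->]]; exists r => //; rewrite cosDpi sinDpi !mulrN. Qed.

Lemma polar_swap f g a : polar f g a -> polar g f (pi / 2 - a).
Proof.
move=> [r r0 [-> ->]]; exists r => //.
by rewrite cosB sinB cos_pihalf sin_pihalf !mul0r !mul1r subr0 add0r.
Qed.

Lemma polar_scale f g a c : 0 < c -> polar (c * f) (c * g) a -> polar f g a.
Proof.
move=> c0 [r r0 [Ef Eg]]; exists (c^-1 * r); first by rewrite mulr_gt0 ?invr_gt0.
by rewrite -!mulrA -Ef -Eg !mulrA mulVf ?mul1r// gt_eqF.
Qed.

Lemma polar_neq0 f g a : polar f g a -> 0 < f ^+ 2 + g ^+ 2.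
Proof.
move=> [r r0 [-> ->]]; rewrite !exprMn -mulrDr cos2Dsin2 mulr1; exact: exprn_gt0.
Qed.

Lemma polarD2piz f g a k : polar f g a -> polar f g (a + k%:~R * (pi *+ 2)).
Proof.
by move=> [r r0 [-> ->]]; exists r => //; have [-> ->] := cos_sinD2piz a k.
Qed.

Lemma polar_uniq f g a b : polar f g a -> polar f g b ->
  exists k, a - b = k%:~R * (pi *+ 2).
Proof.
move=> [r r0 [-> ->]] [s s0 [E1 E2]]; apply: cos_eq1.
have rs : r = s.
  apply/eqP; rewrite -(@eqrXn2 _ 2) ?(ltW r0) ?(ltW s0)//; apply/eqP.
  have -> : r ^+ 2 = (r * cos a) ^+ 2 + (r * sin a) ^+ 2.
    by rewrite !exprMn -mulrDr cos2Dsin2 mulr1.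
  by rewrite E1 E2 !exprMn -mulrDr cos2Dsin2 mulr1.
have rN0 : r != 0 by rewrite gt_eqF.
rewrite -rs in E1 E2; rewrite cosB (mulfI rN0 E1) (mulfI rN0 E2).
by rewrite -!expr2 cos2Dsin2.
Qed.

(* half-angle formula; the branch is cut along the negative real axis *)
Definition parg f g := 2 * atan (g / (Num.sqrt (f ^+ 2 + g ^+ 2) + f)).

Lemma parg_dom f g : 0 < f \/ g != 0 -> 0 < Num.sqrt (f ^+ 2 + g ^+ 2) + f.
Proof.
move=> H; have s0 := sqrtr_ge0 (f ^+ 2 + g ^+ 2).
case: H => [f0|g0]; first by rewrite ltr_wpDl.
rewrite -ltrBlDr sub0r; apply: (@le_lt_trans _ _ `|f|); first by rewrite -normrN ler_norm.
have g2 : 0 < g ^+ 2 by rewrite exprn_even_gt0.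
by rewrite -sqrtr_sqr ltr_sqrt ?ltrDl// ltr_wpDl ?sqr_ge0.
Qed.

Lemma polar_parg f g : 0 < f \/ g != 0 -> polar f g (parg f g).
Proof.
move=> H; have := parg_dom H; rewrite /parg; set s := Num.sqrt _ => s0.
set u := g / (s + f).
have q0 : 0 <= f ^+ 2 + g ^+ 2 by rewrite addr_ge0 ?sqr_ge0.
have s2 : s ^+ 2 = f ^+ 2 + g ^+ 2 by rewrite sqr_sqrtr.
have sN0 : s + f != 0 by rewrite gt_eqF.
have u1 : 0 < 1 + u ^+ 2 by rewrite ltr_pwDl ?sqr_ge0.
have c0 : cos (atan u) != 0 by rewrite cos_atan invr_eq0 gt_eqF// sqrtr_gt0.
have c2 : cos (atan u) ^+ 2 = (1 + u ^+ 2)^-1 by rewrite cos_atan exprVn sqr_sqrtr// ltW.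
have sE : sin (atan u) = u * cos (atan u).
  by rewrite -{2}(atanK u) /tan divfK.
have sgt0 : 0 < s.
  rewrite sqrtr_gt0; case: H => [f0|g0].
    by rewrite ltr_pwDl ?sqr_ge0 ?exprn_gt0.
  by rewrite ltr_wpDl ?sqr_ge0 ?exprn_even_gt0.
exists s => //; rewrite mulr_natl cos_mulr2n sin_mulr2n sE.
have -> : cos (atan u) * (u * cos (atan u)) = u * cos (atan u) ^+ 2 by ring.
(* This is [g ^ 2 = (s - f) * (s + f)]. *)
have uu : 1 + u ^+ 2 = 2 * s / (s + f).
  rewrite /u expr_div_n; have -> : g ^+ 2 = s ^+ 2 - f ^+ 2 by rewrite s2 addrAC subrr add0r.
  by field.
rewrite c2 uu /u; split; first by field; rewrite sN0 gt_eqF.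
by field; rewrite sN0 gt_eqF.
Qed.

Lemma parg0_gt0 g : 0 < g -> parg 0 g = pi / 2.
Proof.
move=> g0; rewrite /parg expr0n /= add0r addr0 sqrtr_sqr gtr0_norm// divff ?gt_eqF//.
by rewrite atan1; field.
Qed.

Lemma parg0_lt0 g : g < 0 -> parg 0 g = - (pi / 2).
Proof.
move=> g0; rewrite /parg expr0n /= add0r addr0 sqrtr_sqr ltr0_norm// invrN mulrN divff ?lt_eqF//.
by rewrite atanN atan1; field.
Qed.

Lemma polar_exists f g : 0 < f ^+ 2 + g ^+ 2 -> exists a, polar f g a.
Proof.
have [f0|f0] := ltP 0 f; first by exists (parg f g); apply: polar_parg; left.
have [->|g0] := eqVneq g 0; last by exists (parg f g); apply: polar_parg; right.
rewrite expr0n addr0 => f2; exists (parg (- f) (- 0) + pi).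
rewrite -[f]opprK -[X in polar _ X]opprK; apply: polar_opp; rewrite opprK.
apply: polar_parg; left; rewrite oppr_gt0 lt_neqAle f0 andbT.
by apply/eqP => fE; rewrite fE expr0n ltxx in f2.
Qed.

End Polar.

Section HasArg.
Variables (R : realType) (T : topologicalType).
Implicit Types (S : set T) (f g : T -> R).

Definition has_arg S f g := exists2 a : T -> R,
  {within S, continuous a} & forall x, S x -> polar (f x) (g x) (a x).

Lemma has_argW S S' f g : S' `<=` S -> has_arg S f g -> has_arg S' f g.
Proof.
move=> SS' [a ac Ha]; exists a; first exact: continuous_subspaceW ac.
by move=> x /SS'; exact: Ha.
Qed.

Lemma has_arg_swap S f g : has_arg S f g -> has_arg S g f.
Proof.
move=> [a ac Ha]; exists (fun x => pi / 2 - a x) => [x|x Sx].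
  by apply: cvgB; [exact: cvg_cst|exact: ac].
by apply: polar_swap; exact: Ha.
Qed.

Lemma has_argM S f g f' g' : has_arg S f g -> has_arg S f' g' ->
  has_arg S (fun x => f x * f' x - g x * g' x) (fun x => f x * g' x + g x * f' x).
Proof.
move=> [a ac Ha] [b bc Hb]; exists (fun x => a x + b x) => [x|x Sx].
  by apply: cvgD; [exact: ac|exact: bc].
by apply: polarM; [exact: Ha|exact: Hb].
Qed.

(** The second pair is [(f + i g)] times the conjugate of [f' + i g']; multiplied by [f' + i g'] it
    gives [f + i g] up to the positive factor [|f' + i g'| ^ 2]. *)
Lemma has_arg_ratio S f g f' g' : has_arg S f' g' ->
  has_arg S (fun x => f x * f' x + g x * g' x) (fun x => g x * f' x - f x * g' x) ->
  has_arg S f g.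
Proof.
move=> H1 H2; have [b _ Hb] := H1; have [a ac Ha] := has_argM H1 H2.
exists a => // x Sx.
apply: (polar_scale (c := f' x ^+ 2 + g' x ^+ 2)).
  exact: polar_neq0 (Hb x Sx).
have := Ha x Sx; congr polar; ring.
Qed.

Lemma continuous_parg S f g : {within S, continuous f} -> {within S, continuous g} ->
  (forall x, S x -> 0 < f x \/ g x != 0) ->
  {within S, continuous (fun x => parg (f x) (g x))}.
Proof.
move=> fc gc H; rewrite continuous_subspace_in => x; rewrite inE => Sx.
apply: cvgM; first exact: cvg_cst.
apply: (@continuous_comp (subspace S) _ _
  (fun x => g x / (Num.sqrt (f x ^+ 2 + g x ^+ 2) + f x)) (@atan R)).
  apply: cvgM; first exact: gc.
  apply: cvgV; first by rewrite gt_eqF// parg_dom//; exact: H.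
  apply: cvgD; last exact: fc.
  apply: (@continuous_comp (subspace S) _ _ (fun x => f x ^+ 2 + g x ^+ 2) Num.sqrt).
    by apply: cvgD; apply: cvgM; by [exact: fc|exact: gc].
  exact: sqrt_continuous.
exact: continuous_atan.
Qed.

(** Dividing by the constant [p + i q] rotates the half plane to the right one, where [parg] is
    continuous. *)
Lemma has_arg_half_plane S f g (p q : R) : {within S, continuous f} ->
  {within S, continuous g} -> (forall x, S x -> 0 < p * f x + q * g x) -> has_arg S f g.
Proof.
move=> fc gc H; have [->|/set0P[x0 Sx0]] := eqVneq S set0.
  by exists (fun=> 0) => [|x []]; exact: continuous_subspace0.
have pq : 0 < p ^+ 2 + q ^+ 2.
  have h0 := H x0 Sx0; rewrite lt_def addr_ge0 ?sqr_ge0// andbT; apply: contraTneq h0 => /eqP.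
  by rewrite paddr_eq0 ?sqr_ge0// !sqrf_eq0 => /andP[/eqP-> /eqP->]; rewrite !mul0r addr0 ltxx.
have [b Hb] := polar_exists pq.
apply: (@has_arg_ratio S f g (fun=> p) (fun=> q)).
  by exists (fun=> b) => // x; exact: cvg_cst.
have H' x : S x -> 0 < f x * p + g x * q by move=> Sx; rewrite mulrC [_ * q]mulrC H.
exists (fun x => parg (f x * p + g x * q) (g x * p - f x * q)).
  apply: continuous_parg => [x|x|x Sx]; last by left; exact: H'.
    by apply: cvgD; apply: cvgM; by [exact: fc|exact: gc|exact: cvg_cst].
  by apply: cvgB; apply: cvgM; by [exact: fc|exact: gc|exact: cvg_cst].
by move=> x Sx; apply: polar_parg; left; exact: H'.
Qed.

End HasArg.

(** * Gluing two arguments along a line *)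

Section Merge.
Variables (R : realType) (T : topologicalType) (S : set T) (c d f g : T -> R).
Hypotheses (hT : hausdorff_space T) (cS : compact S).
Hypotheses (cc : {within S, continuous c}) (dc : {within S, continuous d}).
Hypothesis unif : forall (C : set T) (h : T -> R) (e : R), C `<=` S -> compact C ->
  {within C, continuous h} -> 0 < e -> exists2 r : R, 0 < r & forall x y, C x -> C y ->
  `|c x - c y| <= r -> `|d x - d y| <= r -> `|h x - h y| < e.
Variable t : R.
Let A := S `&` [set x | c x <= t].
Let B := S `&` [set x | t <= c x].
Let C := S `&` [set x | c x = t].
Hypothesis Harg : forall s, (forall x, C x -> d x != s) ->
  has_arg S (fun x => c x - t) (fun x => d x - s).

Let AS : A `<=` S. Proof. by move=> x []. Qed.
Let BS : B `<=` S. Proof. by move=> x []. Qed.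
Let CA : C `<=` A. Proof. by move=> x [Sx /= E]; split => //=; rewrite E. Qed.
Let CB : C `<=` B. Proof. by move=> x [Sx /= E]; split => //=; rewrite E. Qed.

Let cA : compact A.
Proof.
have -> : A = S `&` [set x | - t <= - c x].
  by apply/seteqP; split => x [Sx /= H]; split => //=; move: H; rewrite lerN2.
by apply: compact_superlevel => // x; apply: cvgN; exact: cc.
Qed.

Let cB : compact B. Proof. exact: compact_superlevel. Qed.

Let cC : compact C.
Proof.
have -> : C = A `&` B.
  apply/seteqP; split => x; first by move=> Cx; split; [exact: CA|exact: CB].
  by move=> [[Sx /= h1] [_ /= h2]]; split => //=; apply/eqP; rewrite eq_le h1 h2.
by apply: compact_closedI => //; exact: compact_closed.
Qed.

(* The jump [a - b] of the two arguments across the line [c = t] is locally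
   constant with values in [2 pi Z]; it is removed step by step, from below,
   for growing values of [d]. *)
Let merged (dl s : R) := exists a b : T -> R,
  [/\ {within A, continuous a}, {within B, continuous b},
      forall x, A x -> polar (f x) (g x) (a x),
      forall x, B x -> polar (f x) (g x) (b x) &
      (forall x y, C x -> C y -> `|d x - d y| <= dl -> a x - b x = a y - b y) /\
      (forall x, C x -> d x <= s -> a x = b x)].

(** The jump is an integer multiple of [2 pi]; uniform continuity makes it vary by less than [2 pi],
    hence not at all, between points of [C] with nearby values of [d]. *)
Let merged_start s : has_arg A f g -> has_arg B f g -> (forall x, C x -> s < d x) ->
  exists2 dl, 0 < dl & merged dl s.
Proof.
move=> [a ac Ha] [b bc Hb] Hs.
have nc : {within C, continuous (fun x => a x - b x)}.
  move=> x; apply: cvgB; first exact: (continuous_subspaceW CA ac).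
  exact: (continuous_subspaceW CB bc).
have p0 : 0 < (pi : R) *+ 2 by rewrite pmulrn_lgt0// pi_gt0.
have [r r0 Hr] := unif (fun x (h : C x) => h.1) cC nc p0.
exists r => //; exists a, b; split => //; split => [x y Cx Cy dxy|x Cx]; last first.
  by rewrite leNgt Hs.
have := Hr x y Cx Cy _ dxy; rewrite Cx.2 Cy.2 subrr normr0 (ltW r0) => /(_ isT).
have [k ->] := polar_uniq (Ha x (CA Cx)) (Hb x (CB Cx)).
have [l ->] := polar_uniq (Ha y (CA Cy)) (Hb y (CB Cy)).
rewrite -mulrBl normrM [X in _ * X](gtr0_norm p0) gtr_pMl// -intrB.
by rewrite -intr_norm ltrz1 -[X in _ < X]add0r ltzD1 normr_le0 subr_eq0 => /eqP ->.
Qed.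

(** A nonzero jump at a point [x0] with [d x0] in [(s, s + dl]] rules out points of [C] with
    [d = s], where the jump is 0. Then [(c - t) + i (d - s)] has an argument [e] on [S], and
    comparing [e] with half-plane branches gives multiples of [2 pi], continuous on [A] and on [B],
    that cancel the jump above [s] and leave it alone below. *)
Let merged_step dl s : 0 < dl -> merged dl s -> merged dl (s + dl).
Proof.
move=> dl0 [a [b [ac bc Ha Hb [Hdl Hs]]]].
have [H0|] := pselect (forall x, C x -> d x <= s + dl -> a x = b x).
  by exists a, b; split.
move=> /existsNP[x0 /not_implyP[Cx0 /not_implyP[dx0 nx0]]].
have sx0 : s < d x0 by rewrite ltNge; apply/negP => /(Hs _ Cx0).
have ds x : C x -> d x != s.
  move=> Cx; apply/eqP => E; apply: nx0; apply/eqP; rewrite -subr_eq0.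
  rewrite (Hdl x0 x)// ?(Hs x) ?E ?subrr//.
  by rewrite ger0_norm; lra.
have [e ec He] := Harg ds.
have [k Hk] := polar_uniq (Ha x0 (CA Cx0)) (Hb x0 (CB Cx0)).
have cAc : {within A, continuous c} := continuous_subspaceW AS cc.
have dAc : {within A, continuous d} := continuous_subspaceW AS dc.
have cBc : {within B, continuous c} := continuous_subspaceW BS cc.
have dBc : {within B, continuous d} := continuous_subspaceW BS dc.
(* Branches of the argument of [(c - t) + i (d - s)] on the left and right halves. With the shifts
   [pi] and [2 pi] both equal [3 pi / 2] on the part of [C] below [s]; above [s] they are [pi / 2]
   and [5 pi / 2]. *)
pose eA x := parg (- (c x - t)) (- (d x - s)) + pi.
pose eB x := parg (c x - t) (d x - s) + pi *+ 2.
have domA x : A x -> 0 < - (c x - t) \/ - (d x - s) != 0.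
  move=> [Sx /= cxt]; have [E|ne] := eqVneq (c x) t.
    by right; rewrite oppr_eq0 subr_eq0; apply: ds.
  by left; rewrite oppr_gt0 subr_lt0 lt_neqAle ne.
have domB x : B x -> 0 < c x - t \/ d x - s != 0.
  move=> [Sx /= cxt]; have [E|ne] := eqVneq (c x) t.
    by right; rewrite subr_eq0; apply: ds.
  by left; rewrite subr_gt0 lt_neqAle eq_sym ne.
have HeA x : A x -> polar (c x - t) (d x - s) (eA x).
  move=> Ax; rewrite -[c x - t]opprK -[d x - s]opprK.
  by apply: polar_opp; apply: polar_parg; exact: domA.
have HeB x : B x -> polar (c x - t) (d x - s) (eB x).
  move=> Bx; rewrite /eB -[pi *+ 2]mul1r; apply: (polarD2piz 1).
  by apply: polar_parg; exact: domB.
have eAc : {within A, continuous eA}.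
  move=> x; apply: cvgD; last exact: cvg_cst.
  apply: (continuous_parg _ _ domA) => y; apply: cvgN; apply: cvgB;
    by [exact: cAc|exact: dAc|exact: cvg_cst].
have eBc : {within B, continuous eB}.
  move=> x; apply: cvgD; last exact: cvg_cst.
  apply: (continuous_parg _ _ domB) => y; apply: cvgB;
    by [exact: cBc|exact: dBc|exact: cvg_cst].
have jump x : C x -> eA x - eB x = if s < d x then - (pi *+ 2) else 0.
  move=> Cx; rewrite /eA /eB Cx.2 subrr oppr0.
  have := ds x Cx; rewrite neq_lt => /orP[dxs|sdx].
    rewrite ltNge (ltW dxs) /= parg0_gt0 ?oppr_gt0 ?subr_lt0// parg0_lt0 ?subr_lt0//.
    by rewrite mulr2n; field.
  rewrite sdx parg0_lt0 ?oppr_lt0 ?subr_gt0// parg0_gt0 ?subr_gt0//.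
  by rewrite mulr2n; field.
pose a' x := a x + k%:~R * (eA x - e x).
pose b' x := b x + k%:~R * (eB x - e x).
have jump' x : C x -> a' x - b' x = a x - b x - (if s < d x then a x0 - b x0 else 0).
  move=> Cx; have -> : a' x - b' x = a x - b x + k%:~R * (eA x - eB x).
    by rewrite /a' /b'; ring.
  by rewrite jump//; case: ifP => _; rewrite ?Hk ?mulrN// mulr0 subr0 addr0.
exists a', b'; split.
- move=> x; apply: cvgD; first exact: ac.
  apply: cvgM; first exact: cvg_cst.
  by apply: cvgB; [exact: eAc|exact: (continuous_subspaceW AS ec)].
- move=> x; apply: cvgD; first exact: bc.
  apply: cvgM; first exact: cvg_cst.
  by apply: cvgB; [exact: eBc|exact: (continuous_subspaceW BS ec)].
- move=> x Ax; have [l El] := polar_uniq (HeA x Ax) (He x (AS Ax)).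
  by rewrite /a' El mulrA -intrM; apply: polarD2piz; exact: Ha.
- move=> x Bx; have [l El] := polar_uniq (HeB x Bx) (He x (BS Bx)).
  by rewrite /b' El mulrA -intrM; apply: polarD2piz; exact: Hb.
(* Two points of [C] on either side of [s] and within [dl] would transport the zero jump from below
   [s] to [x0]. *)
have far x y : C x -> C y -> d x <= s -> s < d y -> `|d x - d y| <= dl -> False.
  move=> Cx Cy dx dy dxy; apply: nx0; apply/eqP; rewrite -subr_eq0.
  rewrite (Hdl x0 y)//; first by rewrite -(Hdl x y)// Hs ?subrr.
  by move: dxy; rewrite !ler_norml => /andP[h1 h2]; apply/andP; split; lra.
split => [x y Cx Cy dxy|x Cx dx].
  rewrite !jump'// (Hdl x y)//; congr (_ - _).
  case: ifPn; rewrite -?leNgt => h1; case: ifPn; rewrite -?leNgt => h2 //.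
    by case: (far y x) => //; rewrite distrC.
  by case: (far x y).
apply/eqP; rewrite -subr_eq0 jump'//; case: ifPn; rewrite -?leNgt => h.
  rewrite (Hdl x x0) ?subrr// ler_norml; apply/andP; split; lra.
by rewrite subr0 Hs ?subrr.
Qed.

(** Below all values of [d] on [C] the agreement is vacuous; finitely many steps of length [dl] pass
    the largest value, and arguments that agree on [C] glue over the closed sets [A] and [B]. *)
Lemma has_arg_merge : has_arg A f g -> has_arg B f g -> has_arg S f g.
Proof.
move=> HA HB.
have dCc : {within C, continuous d}.
  by apply: continuous_subspaceW dc => x [].
have dNc : {within C, continuous (fun x => - d x)} by move=> x; apply: cvgN; exact: dCc.
have [s1 Hs1] := continuous_on_bounded cC dNc.
have [s2 Hs2] := continuous_on_bounded cC dCc.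
have [|dl dl0 M0] := @merged_start (- s1 - 1) HA HB.
  by move=> x /Hs1; lra.
have Mn n : merged dl (- s1 - 1 + n%:R * dl).
  elim: n => [|n IH]; first by rewrite mul0r addr0.
  by rewrite -natr1 mulrDl mul1r addrA; exact: merged_step.
pose n := Num.bound `|(s2 + s1 + 1) / dl|.
have ns : s2 <= - s1 - 1 + n%:R * dl.
  have : (s2 + s1 + 1) / dl <= n%:R.
    by apply: (le_trans (ler_norm _)); apply: ltW; apply: archi_boundP; exact: normr_ge0.
  by rewrite ler_pdivrMr//; lra.
have [a [b [ac bc Ha Hb [_ Hn]]]] := Mn n.
have ab x : C x -> a x = b x by move=> Cx; apply: Hn => //; exact: le_trans (Hs2 _ Cx) ns.
pose h x := if c x <= t then a x else b x.
exists h => [|x Sx]; last first.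
  rewrite /h; case: ifPn => [cx|]; first exact: Ha.
  by rewrite -ltNge => /ltW cx; exact: Hb.
have -> : S = A `|` B.
  apply/seteqP; split => [x Sx|x [/AS|/BS]//].
  by have [cx|/ltW cx] := leP (c x) t; [left|right].
apply: withinU_continuous; [exact: compact_closed|exact: compact_closed| |].
  apply: (subspace_eq_continuous _ ac) => x; rewrite inE => -[_ /= cx].
  by rewrite /from_subspace /h cx.
apply: (subspace_eq_continuous _ bc) => x; rewrite inE => -[Sx /= cx]; rewrite /from_subspace /h.
case: ifPn => // cx'; rewrite ab//; split => //=.
by apply/eqP; rewrite eq_le cx cx'.
Qed.

End Merge.

Section Slices.
Variables (R : realType) (T : topologicalType) (S : set T) (c d f g : T -> R).
Hypotheses (hT : hausdorff_space T) (cS : compact S).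
Hypotheses (cc : {within S, continuous c}) (dc : {within S, continuous d}).
Hypothesis unif : forall (C : set T) (h : T -> R) (e : R), C `<=` S -> compact C ->
  {within C, continuous h} -> 0 < e -> exists2 r : R, 0 < r & forall x y, C x -> C y ->
  `|c x - c y| <= r -> `|d x - d y| <= r -> `|h x - h y| < e.
Hypothesis Harg : forall t s, (forall x, S x -> c x = t -> d x != s) ->
  has_arg S (fun x => c x - t) (fun x => d x - s).

(** Slices of width [dl] are attached one at a time along the lines [c = t n]. The functions [c] and
    [d] stand for the two coordinates, in either order. *)
Lemma has_arg_slices (dl : R) : 0 < dl ->
  (forall t, has_arg (S `&` [set x | t <= c x <= t + dl]) f g) -> has_arg S f g.
Proof.
move=> dl0 Hsl.
have cNc : {within S, continuous (fun x => - c x)} by move=> x; apply: cvgN; exact: cc.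
have [s1 Hs1] := continuous_on_bounded cS cNc.
have [s2 Hs2] := continuous_on_bounded cS cc.
pose t n := - s1 + n%:R * dl.
have tS n : t n.+1 = t n + dl by rewrite /t -natr1 mulrDl mul1r addrA.
pose Sn n := S `&` [set x | c x <= t n].
have SnS n : Sn n `<=` S by move=> x [].
have cSn n : compact (Sn n).
  have -> : Sn n = S `&` [set x | - t n <= - c x].
    by apply/seteqP; split => x [Sx /= H]; split => //=; move: H; rewrite lerN2.
  exact: compact_superlevel.
have HSn n : has_arg (Sn n.+1) f g.
  elim: n => [|n IH].
    apply: has_argW (Hsl (t 0%N)) => x [Sx /= cx]; split => //=.
    by rewrite -tS cx andbT /t mul0r addr0; have := Hs1 x Sx; lra.
  apply: (@has_arg_merge _ _ (Sn n.+2) c d f g hT (cSn _) _ _ _ (t n.+1)).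
  - exact: continuous_subspaceW cc.
  - exact: continuous_subspaceW dc.
  - by move=> C h e CS; apply: unif => x /CS/SnS.
  - move=> s Hs; apply: (has_argW (@SnS _)); apply: Harg => x Sx cx.
    by apply: Hs; split => //; split => //=; rewrite cx [leRHS]tS lerDl ltW.
  - by apply: has_argW IH => x [[Sx _] /= cx].
  - by apply: has_argW (Hsl (t n.+1)) => x [[Sx /= c1] /= c2]; split; rewrite //= c2 -tS.
pose n := Num.bound `|(s2 + s1) / dl|.
have ns : s2 <= t n.+1.
  have : (s2 + s1) / dl <= n%:R.
    by apply: (le_trans (ler_norm _)); apply: ltW; apply: archi_boundP; exact: normr_ge0.
  by rewrite tS /t ler_pdivrMr//; lra.
by apply: has_argW (HSn n) => x Sx; split => //=; apply: le_trans ns; exact: Hs2.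
Qed.

End Slices.

(** * Eilenberg's criterion *)

Section Planar.
Variable R : realType.
Implicit Types (L S : set (R * R)) (f g : R * R -> R).

Lemma compact_uniform L f (e : R) : compact L -> {within L, continuous f} -> 0 < e ->
  exists2 r : R, 0 < r & forall x y, L x -> L y ->
    `|x.1 - y.1| <= r -> `|x.2 - y.2| <= r -> `|f x - f y| < e.
Proof.
move=> cL fc e0.
have /compact_near_coveringP/(_ R 0^'+
  (fun (r : R) (x : R * R) => L x -> forall y, L y ->
    `|x.1 - y.1| <= r -> `|x.2 - y.2| <= r -> `|f x - f y| < e)) := cL.
case=> [x Lx|r /= r0 H].
  have e20 : 0 < e / 2 by rewrite divr_gt0.
  have := (subspace_continuousP _ _).1 fc x Lx.
  move=> /cvgrPdist_lt/(_ _ e20); rewrite near_withinE => /nbhs_ballP[s /= s0 Hs].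
  have s20 : 0 < s / 2 by rewrite divr_gt0.
  exists (ball x (s / 2), [set r : R | 0 < r < s / 2]) => /=.
    split; first exact: nbhsx_ballx.
    exists (s / 2) => // r rs r0; apply/andP; split => //.
    by have : `|0 - r| < s / 2 := rs; rewrite sub0r normrN gtr0_norm.
  move=> [y r] /= [[y1 y2] /andP[r0 rs]] Ly z Lz yz1 yz2.
  have hy : `|f x - f y| < e / 2.
    apply: Hs => //; split; apply: (lt_le_trans y1 _) || apply: (lt_le_trans y2 _); lra.
  have hz : `|f x - f z| < e / 2.
    apply: Hs => //; split; rewrite /ball /=.
      rewrite -(subrK y.1 x.1) -addrA (splitr s); apply: (le_lt_trans (ler_normD _ _)).
      by apply: ltr_leD => //; apply: le_trans yz1 (ltW rs).
    rewrite -(subrK y.2 x.2) -addrA (splitr s); apply: (le_lt_trans (ler_normD _ _)).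
    by apply: ltr_leD => //; apply: le_trans yz2 (ltW rs).
  rewrite -(subrK (f x) (f y)) -addrA (splitr e); apply: (le_lt_trans (ler_normD _ _)).
  by apply: ltrD => //; rewrite distrC.
have r20 : 0 < r / 2 by rewrite divr_gt0.
exists (r / 2) => // x y Lx Ly; apply: (H (r / 2)) => //=.
by rewrite sub0r normrN gtr0_norm//; lra.
Qed.

Lemma pair_hausdorff : hausdorff_space (R * R)%type.
Proof. exact: norm_hausdorff. Qed.

(* Eilenberg's criterion: if no translate [x - a], [a] outside [L], winds
   around [L], then no nonvanishing continuous function does. *)
Lemma has_arg_planar L f g : compact L ->
  {within L, continuous f} -> {within L, continuous g} ->
  (forall x, L x -> 0 < f x ^+ 2 + g x ^+ 2) ->
  (forall a, ~ L a -> has_arg L (fun x => x.1 - a.1) (fun x => x.2 - a.2)) ->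
  has_arg L f g.
Proof.
move=> cL fc gc fg0 Harg.
have [->|/set0P L0] := eqVneq L set0.
  by exists (fun=> 0) => [|x []]; exact: continuous_subspace0.
have fst_c S : {within S, continuous (fun x : R * R => x.1)}.
  by apply: continuous_subspaceT => x; exact: cvg_fst.
have snd_c S : {within S, continuous (fun x : R * R => x.2)}.
  by apply: continuous_subspaceT => x; exact: cvg_snd.
have hT := pair_hausdorff.
have qc : {within L, continuous (fun x => f x ^+ 2 + g x ^+ 2)}.
  by move=> x; apply: cvgD; apply: cvgM; by [exact: fc|exact: gc].
have [x0 Lx0 Hx0] := compact_EVT_min L0 cL qc.
set m := f x0 ^+ 2 + _ in Hx0.
have m0 : 0 < m by apply: fg0; rewrite inE in Lx0.
have [G HG] := continuous_on_bounded cL qc.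
have G0 : 0 < G by apply: lt_le_trans (HG x0 _); rewrite inE in Lx0.
(* Write [F = (f, g)]. If the components vary by less than [e] on a cell, then [2 <F x, F y> >= 2 |F
   y| ^ 2 - e * (2 + |F y| ^ 2) >= m > 0] by the choice of [e], so [F] stays in a half plane on the
   cell. *)
pose e := m / (2 * (G + 1)).
have e0 : 0 < e by rewrite divr_gt0// mulr_gt0//; lra.
have eG : e * (2 * (G + 1)) = m by rewrite divfK// gt_eqF// mulr_gt0//; lra.
have [r1 r10 Hr1] := compact_uniform cL fc e0.
have [r2 r20 Hr2] := compact_uniform cL gc e0.
pose dl := Num.min r1 r2.
have dl0 : 0 < dl by rewrite lt_min r10.
have dl1 : dl <= r1 by rewrite ge_min lexx.
have dl2 : dl <= r2 by rewrite ge_min lexx orbT.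
have cell x y : L x -> L y -> `|x.1 - y.1| <= dl -> `|x.2 - y.2| <= dl ->
    0 < f y * f x + g y * g x.
  move=> Lx Ly h1 h2.
  have := Hr1 x y Lx Ly (le_trans h1 dl1) (le_trans h2 dl1).
  have := Hr2 x y Lx Ly (le_trans h1 dl2) (le_trans h2 dl2).
  have : m <= f y ^+ 2 + g y ^+ 2 by apply: Hx0; rewrite inE.
  have := HG y Ly.
  rewrite !ltr_norml => gG mg /andP[g1 g2] /andP[f1 f2].
  have aux u v : - e < u -> u < e -> - (e * (1 + v ^+ 2)) <= 2 * (v * u).
    move=> u1 u2; have h3 : 0 <= (e + u) * (1 + v) ^+ 2.
      by rewrite mulr_ge0 ?sqr_ge0//; lra.
    have h4 : 0 <= (e - u) * (1 - v) ^+ 2 by rewrite mulr_ge0 ?sqr_ge0//; lra.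
    by move: h3 h4; rewrite !expr2 => h3 h4; nra.
  have a1 := aux _ (f y) f1 f2; have a2 := aux _ (g y) g1 g2.
  have a3 : e * (f y ^+ 2 + g y ^+ 2) <= e * G by rewrite ler_wpM2l ?(ltW e0).
  by move: a1 a2 a3 mg m0 eG; rewrite !expr2; nra.
(* In a vertical strip the cells are glued along horizontal lines. A point off the slice is either
   off [L], where the hypothesis applies, or outside the strip, which then lies in a half plane as
   seen from it. *)
have strip t : has_arg (L `&` [set x | t <= x.1 <= t + dl]) f g.
  set S := L `&` _.
  have SL : S `<=` L by move=> x [].
  have cS : compact S.
    have -> : S = (L `&` [set x | t <= x.1]) `&` [set x | - (t + dl) <= - x.1].
      apply/seteqP; split => [x [Lx /= /andP[h1 h2]]|x [[Lx /= h1] /= h2]].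
        by split => //=; rewrite lerN2.
      by split => //=; rewrite h1 -lerN2.
    apply: compact_superlevel; first exact: compact_superlevel.
    by move=> x; apply: cvgN; exact: fst_c.
  apply: (@has_arg_slices _ _ S snd fst f g hT cS (snd_c _) (fst_c _) _ _ dl dl0).
  - move=> C h e' CS cC hc e'0; have [r r0 Hr] := compact_uniform cC hc e'0.
    by exists r => // x y Cx Cy h1 h2; exact: Hr.
  - move=> t' s Hs; apply: has_arg_swap.
    have [st|st] := boolP (t <= s <= t + dl).
      apply: (has_argW SL); apply: (Harg (s, t')) => Lst.
      by have := Hs (s, t') (conj Lst st) erefl; rewrite eqxx.
    have xc : {within S, continuous (fun x => x.1 - s)}.
      by move=> x; apply: cvgB; [exact: fst_c|exact: cvg_cst].
    have yc : {within S, continuous (fun x => x.2 - t')}.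
      by move=> x; apply: cvgB; [exact: snd_c|exact: cvg_cst].
    move: st; rewrite negb_and -!ltNge => /orP[st|st].
      apply: (has_arg_half_plane (p := 1) (q := 0)) => // x [_ /= /andP[h1 h2]].
      by rewrite mul1r mul0r addr0 subr_gt0; apply: lt_le_trans h1.
    apply: (has_arg_half_plane (p := -1) (q := 0)) => // x [_ /= /andP[h1 h2]].
    by rewrite mulN1r mul0r addr0 opprB subr_gt0; apply: le_lt_trans st.
  - move=> t'; set Q := S `&` _.
    have [Q0|/set0P[y [[Ly /andP[y1 y2]] /= /andP[y3 y4]]]] := eqVneq Q set0.
      by rewrite Q0; exists (fun=> 0) => [|x []]; exact: continuous_subspace0.
    have QL : Q `<=` L by move=> x [[]].
    apply: (has_arg_half_plane (p := f y) (q := g y)).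
    + exact: continuous_subspaceW fc.
    + exact: continuous_subspaceW gc.
    move=> x [[Lx /andP[x1 x2]] /= /andP[x3 x4]].
    by apply: cell => //; rewrite ler_norml; apply/andP; split; lra.
apply: (@has_arg_slices _ _ L fst snd f g hT cL (fst_c _) (snd_c _) _ _ dl dl0) => //.
- by move=> C h e' CS cC hc e'0; exact: compact_uniform.
- move=> t s Hs; apply: (Harg (t, s)) => Lts.
  by have := Hs (t, s) Lts erefl; rewrite eqxx.
Qed.

End Planar.

(** * Polynomial hulls in the plane *)

Section PlanarHull.
Variable R : realType.
Implicit Types (E : set (R * R)) (p a x : R * R) (Q : {poly R[i]}).

Definition toC x : R[i] := Complex x.1 x.2.

(** Quantifying over bounds [B] instead of taking a supremum keeps the notion meaningful for every
    [E], even an empty or unbounded one. *)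
Definition planar_hull E : set (R * R) := [set p | forall Q (B : R), 0 <= B ->
  (forall x, E x -> cmod Q.[toC x] <= B) -> cmod Q.[toC p] <= B].

Lemma sub_planar_hull E : E `<=` planar_hull E.
Proof. by move=> x Ex Q B _; apply. Qed.

Lemma continuous_horner_toC Q : continuous (fun x => cmod Q.[toC x]).
Proof.
apply: continuous_cmod; apply: ccontinuous_horner.
by split => x; [exact: cvg_fst|exact: cvg_snd].
Qed.

Lemma closed_planar_hull E : closed (planar_hull E).
Proof.
pose cond := [set QB : {poly R[i]} * R | 0 <= QB.2 /\ forall x, E x -> cmod QB.1.[toC x] <= QB.2].
have -> : planar_hull E = \bigcap_(QB in cond) [set p | cmod QB.1.[toC p] <= QB.2].
  apply/seteqP; split => [p Hp [Q B] [B0 HB]|p Hp Q B B0 HB]; first exact: Hp.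
  exact: (Hp (Q, B)).
apply: closed_bigI => -[Q B] _.
apply: (@closed_comp _ _ (fun x => cmod Q.[toC x]) [set y | y <= B]); last exact: closed_le.
by move=> x _; exact: continuous_horner_toC.
Qed.

Lemma bounded_planar_hull E M p : 0 <= M -> (forall x, E x -> cmod (toC x) <= M) ->
  planar_hull E p -> `|p.1| <= M /\ `|p.2| <= M.
Proof.
move=> M0 HM /(_ 'X M M0) Hp.
have pM : cmod (toC p) <= M by rewrite -[toC p](hornerX); apply: Hp => x /HM; rewrite hornerX.
by split; apply: (le_trans _ pM); [exact: (Re_le_cmod (toC p))|exact: (Im_le_cmod (toC p))].
Qed.

(* If [|Q a'| > sup_E |Q|], then [1 / (z - a')] is a limit of polynomials on
   [E], and so is [1 / (z - a)] for [a] close to [a']; hence [a] is outside the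
   hull as well. *)
Lemma open_planar_hullD E : closed E -> open (planar_hull E `\` E).
Proof.
move=> cE; rewrite openE => a [Ha Ea].
have /nbhs_ballP[d /= d0 Hd] : nbhs a (~` E).
  by apply: open_nbhs_nbhs; split => //; exact: closed_openC.
have d160 : 0 < d / 16 by rewrite divr_gt0.
apply/nbhs_ballP; exists (d / 16) => //= a' aa'.
have Ea' : ~ E a'.
  by apply: Hd; apply: le_ball aa'; lra.
split => //; apply: contrapT => /existsNP[Q /existsNP[B /not_implyP[B0 /not_implyP[HB /negP]]]].
rewrite -ltNge; set m := cmod _ => Bm.
have m0 : 0 < m by apply: le_lt_trans Bm.
have q01 : 0 <= B / m < 1 by rewrite divr_ge0 ?(ltW m0)//= ltr_pdivrMr// mul1r.
have h0 : 0 < 2^-1 :> R by rewrite invr_gt0.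
have [n Hn] := geometric_small q01 h0.
pose c := Q.[toC a']; have c0 : c != 0 by apply: contraTneq m0 => c0; rewrite /m -/c c0 cmod0 ltxx.
(* A peaking power: 1 at [a'] and at most 1/2 on [E]. Its difference from 1 is divisible by
   [X - a'], with quotient [g]. *)
pose Q1 := (c^-1 *: Q) ^+ n.
have Q1E x : E x -> cmod Q1.[toC x] <= 2^-1.
  move=> Ex; rewrite /Q1 horner_exp hornerZ cmodX cmodM cmodV -/m.
  apply: le_trans Hn; have h : m^-1 * cmod Q.[toC x] <= B / m.
    by rewrite mulrC ler_pM2r ?invr_gt0// HB.
  have h' : 0 <= m^-1 * cmod Q.[toC x] by rewrite mulr_ge0 ?cmod_ge0// invr_ge0 ltW.
  by rewrite lerXn2r ?nnegrE// (le_trans h').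
have Q1a : Q1.[toC a'] = 1 by rewrite /Q1 horner_exp hornerZ mulVf// expr1n.
clearbody Q1.
have /factor_theorem[g Hg] : root (1 - Q1) (toC a') by rewrite rootE !hornerE Q1a subrr.
(* [H] is 1 at [a], but on [E] it is at most [1/2 + (3 / d) * (d / 8) = 7/8]: points of [E] are at
   least [d / 2] away from [a'], so [|g| <= (3/2) / (d/2)]. *)
pose H := 1 - g * ('X - (toC a)%:P).
have Hx x : H.[toC x] = Q1.[toC x] + g.[toC x] * (toC a - toC a').
  have := congr1 (fun P => P.[toC x]) Hg; rewrite /H !hornerE => E1.
  have -> : Q1.[toC x] = 1 - (1 - Q1.[toC x]) by rewrite subKr.
  by rewrite E1; ring.
have H1 : H.[toC a] = 1 by rewrite /H !hornerE subrr mulr0 subr0.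
have aa : cmod (toC a - toC a') <= d / 8.
  apply: (le_trans (cmod_le_sum _)) => /=; have [/ltW h1 /ltW h2] := aa'.
  have -> : d / 8 = d / 16 + d / 16 by field.
  exact: lerD.
have gE x : E x -> cmod g.[toC x] <= 3 / d.
  move=> Ex.
  have xa : d / 2 <= cmod (toC x - toC a').
    have : ~ ball a d x by move=> /Hd.
    have [h1 h2] := aa'.
    have k1 := Re_le_cmod (toC x - toC a'); have k2 := Im_le_cmod (toC x - toC a').
    move: h1 h2 k1 k2; rewrite /= /ball /= => h1 h2 k1 k2 nb.
    rewrite leNgt; apply/negP => hlt; apply: nb; split; rewrite /ball /=.
      rewrite -(subrK a'.1 a.1) -addrA; apply: (le_lt_trans (ler_normD _ _)).
      by rewrite [`|a'.1 - _|]distrC; lra.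
    rewrite -(subrK a'.2 a.2) -addrA; apply: (le_lt_trans (ler_normD _ _)).
    by rewrite [`|a'.2 - _|]distrC; lra.
  have E1 := congr1 (fun P => cmod P.[toC x]) Hg; rewrite /= !hornerE cmodM in E1.
  have g0 := cmod_ge0 g.[toC x].
  have : cmod (1 - Q1.[toC x]) <= 3 / 2.
    by apply: (le_trans (cmodD _ _)); rewrite cmodN cmod1; have := Q1E x Ex; lra.
  rewrite E1 => E2; rewrite ler_pdivlMr//.
  have : cmod g.[toC x] * (d / 2) <= 3 / 2 by apply: le_trans E2; rewrite ler_wpM2l.
  by lra.
suff hE x : E x -> cmod H.[toC x] <= 7 / 8.
  by have h78 : 0 <= 7 / 8 :> R by []; have := Ha H _ h78 hE; rewrite H1 cmod1; lra.
move=> Ex; rewrite Hx; apply: (le_trans (cmodD _ _)); rewrite cmodM.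
have : cmod g.[toC x] * cmod (toC a - toC a') <= 3 / d * (d / 8).
  by apply: ler_pM; rewrite ?cmod_ge0 ?gE.
have -> : 3 / d * (d / 8) = 3 / 8 by field; rewrite gt_eqF.
by have := Q1E x Ex; lra.
Qed.

(** A square has no holes: a point outside it lies beyond the line of one of its sides, hence sees
    it in a half plane. *)
Lemma has_arg_box (M : R) (f g : R * R -> R) :
  let Bx := `[- M, M]%classic `*` `[- M, M]%classic : set (R * R) in
  {within Bx, continuous f} -> {within Bx, continuous g} ->
  (forall x, Bx x -> 0 < f x ^+ 2 + g x ^+ 2) -> has_arg Bx f g.
Proof.
move=> Bx fc gc fg; apply: has_arg_planar => //.
  by apply: compact_setX; exact: segment_compact.
move=> a Bxa.
have xc t : {within Bx, continuous (fun x : R * R => x.1 - t)}.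
  by apply: continuous_subspaceT => x; apply: cvgB; [exact: cvg_fst|exact: cvg_cst].
have yc t : {within Bx, continuous (fun x : R * R => x.2 - t)}.
  by apply: continuous_subspaceT => x; apply: cvgB; [exact: cvg_snd|exact: cvg_cst].
have [h1|h1] := ltP a.1 (- M).
  apply: (has_arg_half_plane (p := 1) (q := 0)) => // x [/=].
  by rewrite !in_itv /= => /andP[? ?] _; lra.
have [h2|h2] := ltP M a.1.
  apply: (has_arg_half_plane (p := -1) (q := 0)) => // x [/=].
  by rewrite !in_itv /= => /andP[? ?] _; lra.
have [h3|h3] := ltP a.2 (- M).
  apply: (has_arg_half_plane (p := 0) (q := 1)) => // x [/=].
  by rewrite !in_itv /= => _ /andP[? ?]; lra.
have [h4|h4] := ltP M a.2.
  apply: (has_arg_half_plane (p := 0) (q := -1)) => // x [/=].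
  by rewrite !in_itv /= => _ /andP[? ?]; lra.
by exfalso; apply: Bxa; split; rewrite /= in_itv /= ?h1 ?h2 ?h3 ?h4.
Qed.

(** [th t - t] takes values in [2 pi Z] but drops by [2 pi] over one turn; by the intermediate value
    theorem it also takes the value [th 0 - pi], and parity is violated. *)
Lemma circle_no_arg (th : R -> R) : continuous th -> th 0 = th (pi *+ 2) ->
  (forall t, polar (cos t) (sin t) (th t)) -> False.
Proof.
move=> thc th0 Hth.
have polt (t : R) : polar (cos t) (sin t) t by exists 1; rewrite ?mul1r.
have p0 := pi_gt0 R.
have hc : {within `[0, pi *+ 2], continuous (fun t => th t - t)}.
  by apply: continuous_subspaceT => t; apply: cvgB; [exact: thc|exact: cvg_id].
have hle : 0 <= (pi : R) *+ 2 by rewrite mulrn_wge0// ltW.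
have [|t _ Ht] := @IVT _ (fun t => th t - t) 0 (pi *+ 2) (th 0 - pi) hle hc.
  by rewrite -th0 subr0 ge_min le_max mulr2n; apply/andP; split; apply/orP; [right|left]; lra.
have [k Hk] := polar_uniq (Hth t) (polt t).
have [l Hl] := polar_uniq (Hth 0) (polt 0).
rewrite Hk in Ht; rewrite subr0 in Hl; rewrite Hl in Ht.
have : ((l - k) * 2)%:~R = 1 :> R.
  rewrite intrM intrB; apply: (mulIf (lt0r_neq0 p0)); rewrite mul1r.
  have -> : 2%:~R = 2 :> R by [].
  by move: Ht; rewrite mulr2n; lra.
have -> : (1 : R) = 1%:~R by [].
by move/intr_inj => /(congr1 (fun i => (i %% 2)%Z)); rewrite modzMl.
Qed.

Lemma within_comp_continuous (T U V : topologicalType) (B : set U) (h : U -> V) (ga : T -> U) :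
  {within B, continuous h} -> continuous ga -> (forall t, B (ga t)) -> continuous (h \o ga).
Proof.
move=> hc gac gaB t W /((subspace_continuousP _ _).1 hc _ (gaB t)) => HW.
apply: (@filterS _ (nbhs t) _ _ _ _ (gac t _ HW)) => s /= H.
exact: H (gaB s).
Qed.

(* An argument of [x - p] on [E], extended to the hull, would make [x - p]
   homotopic to a nonvanishing function on a large box, hence have an argument
   on a large circle around [p]. *)
Lemma planar_hull_no_arg E p : compact E -> planar_hull E p -> ~ E p ->
  ~ has_arg E (fun x => x.1 - p.1) (fun x => x.2 - p.2).
Proof.
move=> cE Hp Ep [al alc Hal].
have hT := @pair_hausdorff R.
have clE : closed E := compact_closed hT cE.
have clH := @closed_planar_hull E.
(* [V] and the hull are closed, cover the plane and meet exactly in [E], so functions that agree on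
   [E] can be glued. *)
pose V := ~` (planar_hull E `\` E).
have clV : closed V by apply: open_closedC; exact: open_planar_hullD.
have [M0 HM0] : exists M, forall x, E x -> cmod (toC x) <= M.
  apply: (continuous_on_bounded cE); apply: continuous_subspaceT.
  by have := @continuous_horner_toC 'X; under eq_fun do rewrite hornerX.
pose M := Num.max M0 0.
have M00 : 0 <= M by rewrite le_max lexx orbT.
have HM x : E x -> cmod (toC x) <= M by move=> /HM0 h; rewrite le_max h.
have bH := bounded_planar_hull M00 HM.
have [G HG] := continuous_on_bounded cE alc.
have [G' HG'] : exists G', forall x, E x -> - al x <= G'.
  by apply: (continuous_on_bounded cE) => x; apply: cvgN; exact: alc.
pose G1 := `|G| + `|G'| + 1.
have G10 : 0 < G1 by rewrite ltr_wpDl// addr_ge0.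
have alb x : E x -> `|al x| <= G1.
  move=> Ex; rewrite ler_norml; have := HG x Ex; have := HG' x Ex.
  have := ler_norm G; have := ler_norm G'; have := normr_ge0 G; have := normr_ge0 G'.
  by rewrite /G1; move=> *; apply/andP; split; lra.
(* Tietze extension of the argument from [E] to the plane; on the hull [exp (i be)] replaces the
   direction of [x - p], which is singular at [p]. *)
have [be [beE bec _]] := continuous_bounded_extension (@pseudometric_normal R _) clE G10 alc alb.
pose n (x : R * R) := Num.sqrt ((x.1 - p.1) ^+ 2 + (x.2 - p.2) ^+ 2).
have fst_c : continuous (fun x : R * R => x.1 - p.1).
  by move=> x; apply: cvgB; [exact: cvg_fst|exact: cvg_cst].
have snd_c : continuous (fun x : R * R => x.2 - p.2).
  by move=> x; apply: cvgB; [exact: cvg_snd|exact: cvg_cst].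
have nc : continuous n.
  move=> x; apply: (@continuous_comp _ _ _ (fun x : R * R => (x.1 - p.1) ^+ 2 + (x.2 - p.2) ^+ 2)).
    by apply: cvgD; apply: cvgM; by [exact: fst_c|exact: snd_c].
  exact: sqrt_continuous.
have n0 x : x != p -> 0 < n x.
  move=> xp; rewrite sqrtr_gt0 lt_def addr_ge0 ?sqr_ge0// andbT paddr_eq0 ?sqr_ge0//.
  apply: contra xp; rewrite !sqrf_eq0 !subr_eq0 => /andP[/eqP h1 /eqP h2].
  by apply/eqP; rewrite [x]surjective_pairing h1 h2 -surjective_pairing.
have n2 x : n x ^+ 2 = (x.1 - p.1) ^+ 2 + (x.2 - p.2) ^+ 2.
  by rewrite sqr_sqrtr// addr_ge0 ?sqr_ge0.
have Vp x : V x -> x != p by move=> Vx; apply/eqP => xp; apply: Vx; rewrite xp; split.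
pose inH x := x \in planar_hull E.
pose f x := if inH x then cos (be x) else (x.1 - p.1) / n x.
pose g x := if inH x then sin (be x) else (x.2 - p.2) / n x.
have VH x : V x -> inH x -> E x.
  by move=> Vx; rewrite /inH inE => Hx; apply: contrapT => Ex; exact: Vx.
have fV x : V x -> f x = (x.1 - p.1) / n x /\ g x = (x.2 - p.2) / n x.
  move=> Vx; rewrite /f /g; case: ifP => // Hx.
  have Ex := VH x Vx Hx; have nx0 := n0 x (Vp x Vx).
  have [r r0 [E1 E2]] := Hal x Ex.
  have rn : r = n x.
    apply/eqP; rewrite -(@eqrXn2 _ 2) ?(ltW r0) ?(ltW nx0)//; apply/eqP.
    by rewrite n2 E1 E2 !exprMn -mulrDr cos2Dsin2 mulr1.
  rewrite -(beE x) ?inE// E1 E2 -rn; split; rewrite mulrAC divff ?mul1r// gt_eqF//.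
have split_c (h : R * R -> R) (Bx : set (R * R)) : {within planar_hull E, continuous h} ->
    {within V, continuous h} -> {within Bx, continuous h}.
  move=> hH hV; apply: (@continuous_subspaceW _ _ _ (planar_hull E `|` V)).
    move=> x _; have [Ex|Ex] := pselect (E x); first by left; exact: sub_planar_hull.
    by have [Hx|Hx] := pselect (planar_hull E x); [left|right => -[]].
  exact: withinU_continuous.
have fc Bx : {within Bx, continuous f}.
  apply: split_c.
    apply: (@subspace_eq_continuous _ _ _ (cos \o be)).
      by move=> x Hx; rewrite /from_subspace /f /inH Hx.
    by apply: continuous_subspaceT => x; apply: continuous_comp; [exact: bec|exact: continuous_cos].
  apply: (@subspace_eq_continuous _ _ _ (fun x => (x.1 - p.1) / n x)).
    by move=> x; rewrite inE => Vx; rewrite /from_subspace (fV x Vx).1.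
  apply/subspace_continuousP => x Vx; apply: cvg_within_filter.
  by apply: cvgM; [exact: fst_c|apply: cvgV; [rewrite gt_eqF// n0// Vp|exact: nc]].
have gc Bx : {within Bx, continuous g}.
  apply: split_c.
    apply: (@subspace_eq_continuous _ _ _ (sin \o be)).
      by move=> x Hx; rewrite /from_subspace /g /inH Hx.
    by apply: continuous_subspaceT => x; apply: continuous_comp; [exact: bec|exact: continuous_sin].
  apply: (@subspace_eq_continuous _ _ _ (fun x => (x.2 - p.2) / n x)).
    by move=> x; rewrite inE => Vx; rewrite /from_subspace (fV x Vx).2.
  apply/subspace_continuousP => x Vx; apply: cvg_within_filter.
  by apply: cvgM; [exact: snd_c|apply: cvgV; [rewrite gt_eqF// n0// Vp|exact: nc]].
have fg0 x : 0 < f x ^+ 2 + g x ^+ 2.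
  have [Vx|/contrapT[Hx _]] := pselect (V x).
    have [-> ->] := fV x Vx; have nx0 := n0 x (Vp x Vx).
    by rewrite !expr_div_n -mulrDl -n2 divff ?gt_eqF// exprn_gt0.
  by rewrite /f /g /inH mem_set// cos2Dsin2.
(* The hull lies in the square of half-side [M], so the circle of radius [4 * (M + 1)] around [p]
   avoids it and stays in the box. On the circle [f + i g] is [exp (i t)]. *)
have [th thc Hth] := has_arg_box (fc _) (gc _) (fun x _ => fg0 x) (M := 7 * (M + 1)).
pose rho := 4 * (M + 1).
have rho0 : 0 < rho by rewrite /rho; lra.
pose ga (t : R) := (p.1 + rho * cos t, p.2 + rho * sin t).
have gac : continuous ga.
  have h1 : continuous (fun t => p.1 + rho * cos t).
    by move=> t; apply: cvgD; [exact: cvg_cst|apply: cvgM; [exact: cvg_cst|exact: continuous_cos]].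
  have h2 : continuous (fun t => p.2 + rho * sin t).
    by move=> t; apply: cvgD; [exact: cvg_cst|apply: cvgM; [exact: cvg_cst|exact: continuous_sin]].
  by move=> t; exact: (cvg_pair (h1 t) (h2 t)).
have [p1 p2] := bH p Hp.
have gaB t : (`[- (7 * (M + 1)), 7 * (M + 1)]%classic `*`
    `[- (7 * (M + 1)), 7 * (M + 1)]%classic) (ga t).
  have h1 : `|rho * cos t| <= rho by rewrite normrM (gtr0_norm rho0) ler_piMr ?(ltW rho0)// cos_max.
  have h2 : `|rho * sin t| <= rho by rewrite normrM (gtr0_norm rho0) ler_piMr ?(ltW rho0)// sin_max.
  split; rewrite /= in_itv /= -ler_norml; apply: (le_trans (ler_normD _ _)).
    by move: h1 p1; rewrite /rho; lra.
  by move: h2 p2; rewrite /rho; lra.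
have rs t : (rho * cos t) ^+ 2 + (rho * sin t) ^+ 2 = rho ^+ 2.
  by rewrite !exprMn -mulrDr cos2Dsin2 mulr1.
have gaV t : V (ga t).
  move=> [/bH[h1 h2] _].
  have k1 : `|rho * cos t| <= 2 * M.
    have -> : rho * cos t = (ga t).1 - p.1 by rewrite /ga /= addrC addKr.
    by apply: (le_trans (ler_normB _ _)); lra.
  have k2 : `|rho * sin t| <= 2 * M.
    have -> : rho * sin t = (ga t).2 - p.2 by rewrite /ga /= addrC addKr.
    by apply: (le_trans (ler_normB _ _)); lra.
  have := rs t.
  have : (rho * cos t) ^+ 2 <= (2 * M) ^+ 2.
    by rewrite -(real_normK (num_real _)) lerXn2r ?nnegrE ?mulr_ge0.
  have : (rho * sin t) ^+ 2 <= (2 * M) ^+ 2.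
    by rewrite -[leLHS](real_normK (num_real _)) lerXn2r ?nnegrE ?mulr_ge0.
  set u := _ ^+ 2; set v := (rho * cos t) ^+ 2; rewrite /rho !expr2; nra.
have e1 t : (ga t).1 - p.1 = rho * cos t by rewrite /ga /=; ring.
have e2 t : (ga t).2 - p.2 = rho * sin t by rewrite /ga /=; ring.
have nga t : n (ga t) = rho.
  rewrite /n e1 e2 rs.
  by rewrite sqrtr_sqr gtr0_norm.
apply: (@circle_no_arg (th \o ga)).
- exact: within_comp_continuous thc gac gaB.
- by rewrite /ga /= cos0 sin0 cos2pi sin2pi.
move=> t; have := Hth (ga t) (gaB t); have [-> ->] := fV _ (gaV t).
rewrite nga e1 e2.
by rewrite ![rho * _ / rho]mulrAC !divff ?mul1r// gt_eqF.
Qed.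

End PlanarHull.

(** * Totally real discs *)

Section PartialDerivatives.
Variable R : realType.
Implicit Types (F : 'rV[R]_2 -> R) (x y v : 'rV[R]_2).

Lemma is_derive_line F x v (s : R) : derivable F (s *: v + x) v ->
  is_derive s 1 (fun s => F (s *: v + x)) ('D_v F (s *: v + x)).
Proof.
have E : (fun h : R => h^-1 *: (((fun s => F (s *: v + x)) \o shift s) (h *: 1) - F (s *: v + x))) =
    (fun h : R => h^-1 *: ((F \o shift (s *: v + x)) (h *: v) - F (s *: v + x))).
  apply/funext => h /=; congr (_ *: (F _ - _)).
  by rewrite (_ : h *: (1 : R) = h) ?scalerDl ?addrA//; exact: mulr1.
by move=> dF; split; [rewrite /derivable E|rewrite /derive E].
Qed.

Lemma mean_value_bound (g dg : R -> R) (r B a b : R) :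
  (forall t : R, `|t| < r -> is_derive t 1 g (dg t) /\ `|dg t| <= B) ->
  `|a| < r -> `|b| < r -> `|g b - g a| <= B * `|b - a|.
Proof.
move=> H; wlog ab : a b / a <= b.
  move=> W ar br; have [|/ltW] := leP a b; first by move=> ?; exact: W.
  by move=> ?; rewrite distrC [`|b - a|]distrC; exact: W.
move=> ar br; move: ab; rewrite le_eqVlt => /orP[/eqP->|ab].
  by rewrite !subrr normr0 mulr0.
have inr (t : R) : a <= t <= b -> `|t| < r.
  by move: ar br; rewrite !ltr_norml => /andP[? ?] /andP[? ?] /andP[? ?]; apply/andP; split; lra.
have [||c cab ->] := @MVT _ g dg a b ab.
- by move=> t; rewrite in_itv /= => /andP[/ltW h1 /ltW h2]; apply: (H t _).1; rewrite inr// h1.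
- apply: derivable_within_continuous => t; rewrite in_itv /= => h.
  by have [] := (H t (inr t h)).1.
rewrite normrM ler_wpM2r//; apply: (H c _).2; apply: inr.
by move: cab; rewrite in_itv /= => /andP[/ltW-> /ltW->].
Qed.

(** Bounded partial derivatives make [F] Lipschitz near [x]: the mean value theorem is applied along
    one horizontal and one vertical segment. *)
Lemma continuous_of_partial F x (r B : R) : 0 < r ->
  (forall y i, ball x r y -> derivable F y (e2 R i) /\ `|'D_(e2 R i) F y| <= B) ->
  {for x, continuous F}.
Proof.
move=> r0 H; pose C := `|B| + 1.
have C0 : 0 < C by rewrite ltr_wpDl.
have BC : B <= C by rewrite /C; have := ler_norm B; lra.
apply/(@cvgrPdist_lt _ _ _ (nbhs x) (nbhs_filter x)) => e e0.
have d0 : 0 < Num.min r (e / (2 * C)) by rewrite lt_min r0 divr_gt0// mulr_gt0.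
set d := Num.min _ _ in d0.
have dr : d <= r by rewrite ge_min lexx.
have dC : C * d <= e / 2.
  by rewrite mulrC -ler_pdivlMr// -mulrA -invfM ge_min lexx orbT.
apply/nbhs_ballP; exists d => //= y [_ xy].
pose i0 : 'I_2 := ord0; pose i1 : 'I_2 := 1%:R.
pose a := y ord0 i0 - x ord0 i0; pose b := y ord0 i1 - x ord0 i1.
have ad : `|a| < d by rewrite /a distrC; exact: xy.
have bd : `|b| < d by rewrite /b distrC; exact: xy.
have e2E i j : e2 R i ord0 j = (j == i)%:R by rewrite !mxE eqxx.
have yE : y = b *: e2 R i1 + (a *: e2 R i0 + x).
  apply/rowP => j; rewrite !mxE !eqxx /=.
  have [->|j1] := eqVneq j i1; first by rewrite mulr1 mulr0 add0r /b subrK.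
  have -> : j = i0 by move: j1; case: j => -[|[|//]] p //= _; apply: val_inj.
  by rewrite mulr1 mulr0 add0r /a subrK.
have in_ball (s t : R) : `|s| < r -> `|t| < r -> ball x r (t *: e2 R i1 + (s *: e2 R i0 + x)).
  move=> sr tr; split => // k j; rewrite (ord1 k) /ball /= !mxE eqxx /=.
  have [->|j1] := eqVneq j i1.
    by rewrite mulr1 mulr0 add0r opprD addrCA subrr addr0 normrN.
  have -> : j = i0 by move: j1; case: j => -[|[|//]] p //= _; apply: val_inj.
  by rewrite mulr1 mulr0 add0r opprD addrCA subrr addr0 normrN.
have r00 : `|0 : R| < r by rewrite normr0.
have h1 : `|F y - F (a *: e2 R i0 + x)| <= B * `|b|.
  have := @mean_value_bound (fun t => F (t *: e2 R i1 + (a *: e2 R i0 + x)))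
    (fun t => 'D_(e2 R i1) F (t *: e2 R i1 + (a *: e2 R i0 + x))) r B 0 b.
  rewrite scale0r add0r subr0 -yE; apply => //; last exact: lt_le_trans bd dr.
  move=> t tr; have [h1 h2] := H _ i1 (in_ball a t (lt_le_trans ad dr) tr).
  by split; [exact: is_derive_line|exact: h2].
have h2 : `|F (a *: e2 R i0 + x) - F x| <= B * `|a|.
  have := @mean_value_bound (fun t => F (t *: e2 R i0 + x))
    (fun t => 'D_(e2 R i0) F (t *: e2 R i0 + x)) r B 0 a.
  rewrite scale0r add0r subr0; apply => //; last exact: lt_le_trans ad dr.
  move=> t tr; have := in_ball t 0 tr r00; rewrite scale0r add0r => bt.
  have [h2 h3] := H _ i0 bt.
  by split; [exact: is_derive_line|exact: h3].
rewrite distrC -(subrK (F (a *: e2 R i0 + x)) (F y)) -addrA.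
apply: (le_lt_trans (ler_normD _ _)); rewrite (splitr e).
have k1 : B * `|a| <= C * `|a| by rewrite ler_wpM2r.
have k2 : B * `|b| <= C * `|b| by rewrite ler_wpM2r.
have k3 : C * `|a| < C * d by rewrite ltr_pM2l.
have k4 : C * `|b| < C * d by rewrite ltr_pM2l.
by apply: ltrD; lra.
Qed.

Lemma C1_on_continuous U (phi : 'rV[R]_2 -> 'rV[R]_4) x j : C1_on U phi -> U x ->
  {for x, continuous (fun y => phi y ord0 j)}.
Proof.
move=> [oU HU] Ux.
have DE y i : U y -> 'D_(e2 R i) (fun y => phi y ord0 j) y = ('D_(e2 R i) phi y) ord0 j.
  by move=> Uy; rewrite derive_mx ?mxE//; exact: (HU i).1.
have Dd y i : U y -> derivable (fun y => phi y ord0 j) y (e2 R i).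
  by move=> Uy; apply: (derivable_mxP _ _ _).1; exact: (HU i).1.
have [r0 r00 Hr0] : exists2 r : R, 0 < r & ball x r `<=` U.
  by have /nbhs_ballP[r /= ? ?] : nbhs x U by [apply: open_nbhs_nbhs]; exists r.
pose B i := `|('D_(e2 R i) phi x) ord0 j| + 1.
have near_bound i : exists2 r : R, 0 < r & forall y, ball x r y -> U y ->
    `|('D_(e2 R i) phi y) ord0 j| <= B i.
  have [_ Dc] := HU i.
  have := (subspace_continuousP _ _).1 Dc x Ux => Dcx.
  have : (fun y => ('D_(e2 R i) phi y) ord0 j) @ within U (nbhs x) --> ('D_(e2 R i) phi x) ord0 j.
    exact: (cvg_comp _ _ Dcx (@coord_continuous R 1 4 ord0 j _)).
  move=> /cvgrPdist_lt/(_ _ ltr01); rewrite near_withinE => /nbhs_ballP[r /= r00' Hr].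
  exists r => // y xy Uy; have := Hr y xy Uy; rewrite /B.
  move=> h; rewrite -[X in `|X|](subrK (('D_(e2 R i) phi x) ord0 j)) addrC.
  by apply: (le_trans (ler_normD _ _)); rewrite lerD2l distrC ltW.
have [r1 r10 Hr1] := near_bound ord0.
have [r2 r20 Hr2] := near_bound 1%:R.
pose r := Num.min r0 (Num.min r1 r2).
apply: (@continuous_of_partial _ x r (Num.max (B ord0) (B 1%:R))).
  by rewrite !lt_min r00 r10 r20.
move=> y i xy.
have Uy : U y by apply: Hr0; apply: le_ball xy; rewrite ge_min lexx.
split; first exact: Dd.
rewrite DE// le_max; have [->|i1] := eqVneq i 1%:R.
  by apply/orP; right; apply: Hr2 => //; apply: le_ball xy; rewrite !ge_min lexx !orbT.
have -> : i = ord0 by move: i1; case: i => -[|[|//]] p //= _; apply: val_inj.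
by apply/orP; left; apply: Hr1 => //; apply: le_ball xy; rewrite !ge_min lexx !orbT.
Qed.

End PartialDerivatives.

Section TotallyReal.
Variable R : realType.
Implicit Types (v : 'rV[R]_4).

Lemma toC2_inj : injective (@toC2 R).
Proof.
move=> u v [h0 h1 h2 h3]; apply/rowP => -[[|[|[|[|//]]]] p].
- by have -> : Ordinal p = 0%:R by apply: val_inj.
- by have -> : Ordinal p = 1%:R by apply: val_inj.
- by have -> : Ordinal p = 2%:R by apply: val_inj.
- by have -> : Ordinal p = 3%:R by apply: val_inj.
Qed.

Lemma toC2_comb (a b : R) v w : toC2 (a *: v + b *: w) =
  (a%:C%C * (toC2 v).1 + b%:C%C * (toC2 w).1, a%:C%C * (toC2 v).2 + b%:C%C * (toC2 w).2).
Proof. by rewrite /toC2 !mxE; congr pair; simpc. Qed.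

Lemma toC2_multJ v : toC2 (multJ v) = ('i%C * (toC2 v).1, 'i%C * (toC2 v).2).
Proof. by rewrite /toC2 !mxE /=; congr pair; simpc. Qed.

(** If both tangent vectors are complex multiples of [p], real independence makes [k1] and [k2] a
    real basis of the complex numbers, and the tangent plane is invariant under [i]. *)
Lemma not_totally_real_of_parallel (phi : 'rV[R]_2 -> 'rV[R]_4) x (p : C2 R) (k1 k2 : R[i]) :
  immersive_totally_real_at phi x ->
  toC2 ('D_(e2 R ord0) phi x) = (k1 * p.1, k1 * p.2) ->
  toC2 ('D_(e2 R 1%:R) phi x) = (k2 * p.1, k2 * p.2) -> False.
Proof.
rewrite /immersive_totally_real_at; set v1 := 'D_ _ _ _; set v2 := 'D_ _ _ _.
clearbody v1 v2; move=> [indep treal] E1 E2.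
have z0 : toC2 (0 : 'rV[R]_4) = (0, 0) by rewrite /toC2 !mxE.
have comb a b : a%:C%C * k1 + b%:C%C * k2 = 0 -> a = 0 /\ b = 0.
  move=> H; apply: indep; apply: toC2_inj; rewrite toC2_comb E1 E2 z0.
  by rewrite ![fst _]/= ![snd _]/= !mulrA -!mulrDl H !mul0r.
case: k1 E1 comb => x1 y1 E1; case: k2 E2 => x2 y2 E2 comb.
pose De := x1 * y2 - y1 * x2.
have zE (u w : R) : u = 0 -> w = 0 -> Complex u w = 0 by move=> -> ->.
have De0 : De != 0.
  apply/eqP => D0.
  have [hx2 hx1] : x2 = 0 /\ - x1 = 0.
    by apply: comb; simpc; apply: zE; [ring|move: D0; rewrite /De; lra].
  have [hy2 hy1] : y2 = 0 /\ - y1 = 0.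
    by apply: comb; simpc; apply: zE; [move: D0; rewrite /De; lra|ring].
  have [h _] : 1 = 0 :> R /\ 0 = 0 :> R.
    by apply: comb; simpc; apply: zE; lra.
  by have := oner_neq0 R; rewrite h eqxx.
(* Cramer's rule for [a k1 + b k2 = i k1]. *)
pose b := (x1 ^+ 2 + y1 ^+ 2) / De; pose a := - (y1 * y2 + x1 * x2) / De.
have EJ : a *: v1 + b *: v2 = multJ (1 *: v1 + 0 *: v2).
  apply: toC2_inj; rewrite scale1r scale0r addr0 toC2_multJ toC2_comb E1 E2.
  rewrite ![fst _]/= ![snd _]/=.
  have Ek : a%:C%C * Complex x1 y1 + b%:C%C * Complex x2 y2 = 'i%C * Complex x1 y1.
    by simpc; rewrite /a /b; congr Complex; rewrite /De; field; exact: De0.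
  by rewrite !mulrA -!mulrDl Ek.
have [a0 b0] := indep _ _ (treal _ _ _ _ EJ).
have : x1 ^+ 2 + y1 ^+ 2 = 0.
  by move/eqP: b0; rewrite /b mulf_eq0 invr_eq0 (negbTE De0) orbF => /eqP.
move/eqP; rewrite paddr_eq0 ?sqr_ge0// !sqrf_eq0 => /andP[/eqP x10 /eqP y10].
by move/eqP: De0; apply; rewrite /De x10 y10 !mul0r subrr.
Qed.

End TotallyReal.

(** * Level sets of a function without interior extrema *)

Section LevelSets.
Variable R : realType.
Implicit Types (L D : set (R * R)) (a x : R * R).

(** For [a'] and [b'] close to [a], compared with the distance of [a] to [L], the quotient
    [(x - b') / (x - a')] has positive real part on [L]. So having an argument is locally constant
    in the translation. *)
Lemma has_arg_translate_near L a : closed L -> ~ L a ->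
  exists2 r : R, 0 < r & forall a' b', ball a r a' -> ball a r b' ->
    has_arg L (fun x => x.1 - a'.1) (fun x => x.2 - a'.2) ->
    has_arg L (fun x => x.1 - b'.1) (fun x => x.2 - b'.2).
Proof.
move=> cL La.
have /nbhs_ballP[d /= d0 Hd] : nbhs a (~` L).
  by apply: open_nbhs_nbhs; split => //; exact: closed_openC.
exists (d / 8); first by rewrite divr_gt0.
move=> a' b' [a1 a2] [b1 b2] H; apply: (has_arg_ratio H).
have xc t : {within L, continuous (fun x : R * R => x.1 - t)}.
  by apply: continuous_subspaceT => x; apply: cvgB; [exact: cvg_fst|exact: cvg_cst].
have yc t : {within L, continuous (fun x : R * R => x.2 - t)}.
  by apply: continuous_subspaceT => x; apply: cvgB; [exact: cvg_snd|exact: cvg_cst].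
apply: (has_arg_half_plane (p := 1) (q := 0)).
- by move=> x; apply: cvgD; apply: cvgM; by [exact: xc|exact: yc].
- by move=> x; apply: cvgB; apply: cvgM; by [exact: xc|exact: yc].
move=> x Lx; rewrite mul1r mul0r addr0.
have far : d <= `|a.1 - x.1| \/ d <= `|a.2 - x.2|.
  apply: contrapT => /not_orP[/negP h1 /negP h2]; apply: (Hd x) => //.
  by split; rewrite /ball /= ltNge.
move: a1 a2 b1 b2; rewrite /ball /= => a1 a2 b1 b2.
(* In the coordinate where [x] is far from [a] the product is at least [(7 d / 8) ^ 2]; in the other
   it is at least [- (s - t) ^ 2 / 4], hence at least [- d ^ 2 / 64]. *)
have key (u s t : R) : `|u - s| < d / 8 -> `|u - t| < d / 8 ->
    forall y, - (d ^+ 2 / 64) <= (y - s) * (y - t) /\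
    (d <= `|u - y| -> d ^+ 2 * 49 / 64 <= (y - s) * (y - t)).
  rewrite !ltr_norml => /andP[s1 s2] /andP[t1 t2] y; split.
    have h : (s - t) ^+ 2 <= (d / 4) ^+ 2.
      rewrite -[leLHS]real_normK ?num_real// lerXn2r ?nnegrE//; first by lra.
      by rewrite ler_norml; apply/andP; split; lra.
    have := sqr_ge0 (y - (s + t) / 2); move: h; rewrite !expr2; nra.
  rewrite ler_normr => /orP[h|h].
    have h1 : 7 * d / 8 <= s - y by lra.
    have h2 : 7 * d / 8 <= t - y by lra.
    have : (7 * d / 8) * (7 * d / 8) <= (s - y) * (t - y) by apply: ler_pM => //; lra.
    by rewrite expr2; lra.
  have h1 : 7 * d / 8 <= y - s by lra.
  have h2 : 7 * d / 8 <= y - t by lra.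
  have : (7 * d / 8) * (7 * d / 8) <= (y - s) * (y - t) by apply: ler_pM => //; lra.
  by rewrite expr2; lra.
have [k1 k2] := key _ _ _ b1 a1 x.1; have [k3 k4] := key _ _ _ b2 a2 x.2.
have d2 : 0 < d ^+ 2 by rewrite exprn_gt0.
by case: far => [/k2|/k4]; lra.
Qed.

Definition unit_disc : set (R * R) := [set x | x.1 ^+ 2 + x.2 ^+ 2 <= 1].

Lemma has_arg_outside_disc L a : L `<=` unit_disc -> ~ unit_disc a ->
  has_arg L (fun x => x.1 - a.1) (fun x => x.2 - a.2).
Proof.
move=> LD /negP; rewrite -ltNge => a1.
apply: (has_arg_half_plane (p := - a.1) (q := - a.2)).
- by apply: continuous_subspaceT => x; apply: cvgB; [exact: cvg_fst|exact: cvg_cst].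
- by apply: continuous_subspaceT => x; apply: cvgB; [exact: cvg_snd|exact: cvg_cst].
move=> x /LD; rewrite /unit_disc /=.
have := sqr_ge0 (x.1 - a.1); have := sqr_ge0 (x.2 - a.2).
by rewrite !expr2 in a1 *; nra.
Qed.

Lemma compact_unit_disc : compact unit_disc.
Proof.
have -> : unit_disc = (`[(-1 : R), 1]%classic `*` `[(-1 : R), 1]%classic) `&`
    [set x | -1 <= - (x.1 ^+ 2 + x.2 ^+ 2)].
  apply/seteqP; split => [x xD|x [_ /=]]; last by rewrite lerN2.
  have := sqr_ge0 x.1; have := sqr_ge0 x.2; move: xD; rewrite /unit_disc /= !expr2 => xD h1 h2.
  by split; [split; rewrite /= in_itv /=; apply/andP; split; nra|rewrite /= lerN2].
apply: compact_superlevel; first by apply: compact_setX; exact: segment_compact.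
apply: continuous_subspaceT => x; apply: cvgN; apply: cvgD; apply: cvgM;
  by [exact: cvg_fst|exact: cvg_snd].
Qed.

Variable h : R * R -> R.
Hypothesis hc : {within unit_disc, continuous h}.
Hypothesis h_no_extremum : forall x0 (r sg : R), 0 < r -> sg = 1 \/ sg = -1 ->
  ball x0 r `<=` unit_disc -> (forall x, ball x0 r x -> sg * h x <= sg * h x0) -> False.

Definition level c := unit_disc `&` [set x | h x = c].

Lemma compact_level c : compact (level c).
Proof.
have -> : level c = (unit_disc `&` [set x | c <= h x]) `&` [set x | - c <= - h x].
  apply/seteqP; split => [x [Dx /= <-]|x [[Dx /= h1] /= h2]]; first by [].
  by split => //=; apply/eqP; rewrite eq_le h1 andbT -lerN2.
have h1 := compact_superlevel (b := c) compact_unit_disc hc.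
apply: compact_superlevel => //.
apply: (@continuous_subspaceW _ _ _ unit_disc); first by move=> x [].
by move=> x; apply: cvgN; exact: hc.
Qed.

(* The points [a] around which the level set winds would form a bounded open
   set whose boundary lies in the level set, so that [h] would have an
   extremum there. *)
Lemma has_arg_level c a : ~ level c a ->
  has_arg (level c) (fun x => x.1 - a.1) (fun x => x.2 - a.2).
Proof.
move=> La; apply: contrapT => Na.
have cL := @compact_level c.
have clL : closed (level c) := compact_closed (@pair_hausdorff R) cL.
have LD : level c `<=` unit_disc by move=> x [].
pose W : set (R * R) := [set a | ~ level c a /\
  ~ has_arg (level c) (fun x => x.1 - a.1) (fun x => x.2 - a.2)].
have WD : W `<=` unit_disc.
  by move=> x [_ nx]; apply: contrapT => nD; apply: nx; exact: has_arg_outside_disc.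
have oW : open W.
  rewrite openE => x [Lx nx].
  have [r r0 Hr] := has_arg_translate_near clL Lx.
  have := open_nbhs_nbhs (conj (closed_openC clL) Lx : open_nbhs x (~` level c)).
  have : nbhs x (ball x r) by exact: nbhsx_ballx.
  apply: filterS2 => y xy Ly; split => // hy; apply: nx.
  exact: Hr xy (ballxx _ r0) hy.
have clWL : closed (W `|` level c).
  rewrite -[W `|` _]setCK; apply: open_closedC; rewrite openE => x.
  rewrite /setC /= => /not_orP[Wx Lx].
  have hx : has_arg (level c) (fun y => y.1 - x.1) (fun y => y.2 - x.2).
    by apply: contrapT => nx; apply: Wx.
  have [r r0 Hr] := has_arg_translate_near clL Lx.
  have := open_nbhs_nbhs (conj (closed_openC clL) Lx : open_nbhs x (~` level c)).
  have : nbhs x (ball x r) by exact: nbhsx_ballx.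
  apply: filterS2 => y xy Ly [[_ ny]|//]; apply: ny.
  exact: Hr (ballxx _ r0) xy hx.
have WLD : W `|` level c `<=` unit_disc by move=> x [/WD|/LD].
have cWL : compact (W `|` level c).
  rewrite -(setIidr WLD); exact: compact_closedI compact_unit_disc clWL.
have Wa : W a by split.
have WL0 : W `|` level c !=set0 by exists a; left.
(* [h a] differs from [c], since [a] lies in the disc off the level set. The sign [sg] makes
   [sg * h] exceed its value on the level set at [a], so its maximum over [W] and the level set is
   reached in the open set [W]. *)
suff main (sg : R) : sg = 1 \/ sg = -1 -> sg * c < sg * h a -> False.
  have [/eqP|] := boolP (h a == c).
    by move=> hac; apply: La; split => //; exact: WD.
  rewrite neq_lt => /orP[ac|ca].
    by apply: (main (-1)); [right|rewrite !mulN1r ltrN2].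
  by apply: (main 1); [left|rewrite !mul1r].
move=> sg1 sgc.
have shc : {within W `|` level c, continuous (fun x => sg * h x)}.
  move=> x; apply: cvgM; first exact: cvg_cst.
  exact: (continuous_subspaceW WLD hc).
have [x0 x0W Hx0] := compact_EVT_max WL0 cWL shc.
have Wx0 : W x0.
  move: x0W; rewrite inE => -[//|[_ /= hx0]].
  have := Hx0 a; rewrite inE hx0 => /(_ (or_introl Wa)).
  by rewrite leNgt sgc.
have /nbhs_ballP[r /= r0 Hr] : nbhs x0 W by exact: open_nbhs_nbhs.
apply: (@h_no_extremum x0 r sg r0 sg1).
  by move=> x /Hr /WD.
by move=> x /Hr Wx; apply: Hx0; rewrite inE; left.
Qed.

Lemma has_arg_level_fun c (f g : R * R -> R) : {within unit_disc, continuous f} ->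
  {within unit_disc, continuous g} ->
  (forall x, level c x -> 0 < f x ^+ 2 + g x ^+ 2) -> has_arg (level c) f g.
Proof.
move=> fc gc fg; apply: has_arg_planar => //.
- exact: compact_level.
- by apply: continuous_subspaceW fc => x [].
- by apply: continuous_subspaceW gc => x [].
- by move=> a; exact: has_arg_level.
Qed.

Lemma has_arg_levels (P : R -> Prop) (e : R) (f g : R * R -> R) : 0 < e ->
  {within unit_disc, continuous f} -> {within unit_disc, continuous g} ->
  (forall c d, P c -> P d -> `|c - d| < e -> c = d) ->
  (forall x, unit_disc x -> P (h x) -> 0 < f x ^+ 2 + g x ^+ 2) ->
  has_arg (unit_disc `&` [set x | P (h x)]) f g.
Proof.
move=> e0 fc gc Psep fg.
have : forall c, exists al : R * R -> R, P c ->
    {within level c, continuous al} /\ forall x, level c x -> polar (f x) (g x) (al x).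
  move=> c; have [Pc|nPc] := pselect (P c); last by exists (fun=> 0).
  have [|al alc Hal] := @has_arg_level_fun c f g fc gc.
    by move=> x [Dx /= hx]; apply: fg => //; rewrite hx.
  by exists al.
move=> /choice[al Hal]; exists (fun x => al (h x) x) => [|x [Dx /= Px]]; last first.
  by have [_ H] := Hal _ Px; apply: H; split.
apply/subspace_continuousP => x [Dx Px] A /= HA.
have [alc _] := Hal _ Px.
have Lx : level (h x) x by split.
have := (subspace_continuousP _ _).1 alc x Lx A HA.
have := (subspace_continuousP _ _).1 hc x Dx => /cvgrPdist_lt/(_ _ e0).
rewrite /= !near_withinE => H1 H2.
change (nbhs x [set y | (unit_disc `&` [set x | P (h x)]) y -> A (al (h y) y)]).
apply: filterS2 H1 H2 => y H1 H2 [Dy Py].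
have hxy : h x = h y by apply: Psep => //; exact: H1.
by rewrite -hxy; apply: H2; split.
Qed.

End LevelSets.

(** A continuous injection of a compact set into a Hausdorff space is a homeomorphism onto its
    image. *)
Lemma has_arg_image (R : realType) (T U : topologicalType) (S : set T) (G : T -> U)
    (f g : U -> R) : hausdorff_space U -> compact S -> {within S, continuous G} ->
  {in S &, injective G} -> has_arg S (f \o G) (g \o G) -> has_arg (G @` S) f g.
Proof.
move=> hU cS Gc Ginj [al alc Hal].
have [S0|/set0P[x0 Sx0]] := eqVneq S set0.
  by rewrite S0 image_set0; exists (fun=> 0) => [|x []]; exact: continuous_subspace0.
have : forall u, exists x, (G @` S) u -> S x /\ G x = u.
  move=> u; have [[x Sx <-]|nu] := pselect ((G @` S) u); last by exists x0.
  by exists x.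
move=> /choice[gi Hgi].
have giK x : S x -> gi (G x) = x.
  move=> Sx; have [Sg E] := Hgi (G x) (ex_intro2 _ _ x Sx erefl).
  by apply: Ginj => //; rewrite inE.
exists (al \o gi) => [|_ [x Sx <-]]; last by rewrite /= giK//; exact: Hal.
apply/continuous_closedP => A cA; apply/closed_subspaceP.
have [V cV VE] := (closed_subspaceP _ _).1 ((continuous_closedP _).1 alc A cA).
exists (G @` (V `&` S)).
  apply: compact_closed => //; apply: continuous_compact.
    by apply: continuous_subspaceW Gc => x [].
  by rewrite setIC; exact: compact_closedI.
apply/seteqP; split => u.
  move=> [[x VSx <-] _]; have Sx := VSx.2; move: VSx; rewrite VE => -[Ax _].
  by split; [change (A (al (gi (G x)))); rewrite giK|exists x].
move=> [Au [x Sx xu]]; split; last by exists x.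
exists x => //; rewrite VE; split => //.
by have Au' : A (al (gi u)) := Au; rewrite -xu giK in Au'.
Qed.

Lemma local_max_deriv (R : realType) (f : R -> R) (df r : R) : 0 < r ->
  (forall s : R, `|s| < r -> derivable f s 1) -> is_derive (0 : R) 1 f df ->
  (forall s : R, `|s| < r -> f s <= f 0) -> df = 0.
Proof.
move=> r0 fd f0 fmax.
have inr (t : R) : t \in `]- r, r[%R -> `|t| < r by rewrite in_itv /= ltr_norml.
have : is_derive (0 : R) 1 f 0.
  apply: (@derive1_at_max _ f (- r) r).
  - by lra.
  - by move=> t /inr; exact: fd.
  - by rewrite in_itv /=; apply/andP; split; lra.
  - by move=> t /inr; exact: fmax.
by move: f0 => [_ E1] [_ E2]; rewrite -E1 E2.
Qed.

(** With [z = a + i b] and [w = c + i d], this covers the imaginary and real parts of [z] times the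
    conjugate of [w], and the squared moduli, so that one formula yields both extremality conditions
    of the next lemma. *)
Lemma is_derive_quad (R : realType) (a b c d : R -> R) (s da db dc dd p q u v : R) :
  is_derive s 1 a da -> is_derive s 1 b db -> is_derive s 1 c dc -> is_derive s 1 d dd ->
  is_derive s 1 (fun s => (b s * c s - a s * d s) * p + (a s * c s + b s * d s) * q +
      (a s * a s + b s * b s) * u + (c s * c s + d s * d s) * v)
     ((db * c s + b s * dc - da * d s - a s * dd) * p +
      (da * c s + a s * dc + db * d s + b s * dd) * q +
      (da * a s + a s * da + db * b s + b s * db) * u +
      (dc * c s + c s * dc + dd * d s + d s * dd) * v).
Proof.
move=> Ha Hb Hc Hd.
have M (f g : R -> R) (df dg : R) : is_derive s 1 f df -> is_derive s 1 g dg ->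
    is_derive s 1 (fun s => f s * g s) (df * g s + f s * dg).
  move=> Hf Hg; apply: (is_derive_eq (is_deriveM Hf Hg)).
  by rewrite /GRing.scale /= addrC [g s * _]mulrC.
have S (f g : R -> R) (df dg : R) : is_derive s 1 f df -> is_derive s 1 g dg ->
    is_derive s 1 (fun s => f s + g s) (df + dg) by move=> Hf Hg; exact: is_deriveD.
have B (f g : R -> R) (df dg : R) : is_derive s 1 f df -> is_derive s 1 g dg ->
    is_derive s 1 (fun s => f s - g s) (df - dg) by move=> Hf Hg; exact: is_deriveB.
have Z (f : R -> R) (df k : R) : is_derive s 1 f df -> is_derive s 1 (fun s => f s * k) (df * k).
  move=> Hf; have := M f (fun=> k) df 0 Hf (is_derive_cst k s 1); rewrite mulr0 addr0.
  by [].
have H := S _ _ _ _ (S _ _ _ _ (S _ _ _ _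
  (Z _ _ p (B _ _ _ _ (M _ _ _ _ Hb Hc) (M _ _ _ _ Ha Hd)))
  (Z _ _ q (S _ _ _ _ (M _ _ _ _ Ha Hc) (M _ _ _ _ Hb Hd))))
  (Z _ _ u (S _ _ _ _ (M _ _ _ _ Ha Ha) (M _ _ _ _ Hb Hb))))
  (Z _ _ v (S _ _ _ _ (M _ _ _ _ Hc Hc) (M _ _ _ _ Hd Hd))).
by apply: (is_derive_eq H); ring.
Qed.

(* For the curve [(z, w) = (a + i b, c + i d)], the hypotheses say that
   [|z| = |w|] and that [arg (z / w)] is extremal at [0]; then [z' / z = w' / w]
   at [0]. *)
Lemma curve_parallel (R : realType) (a b c d da db dc dd : R -> R) (r sg : R) : 0 < r ->
  sg != 0 ->
  (forall s : R, `|s| < r -> is_derive s 1 a (da s) /\ is_derive s 1 b (db s) /\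
     is_derive s 1 c (dc s) /\ is_derive s 1 d (dd s)) ->
  (forall s : R, `|s| < r -> a s * a s + b s * b s = c s * c s + d s * d s) ->
  0 < c 0 * c 0 + d 0 * d 0 ->
  (forall s : R, `|s| < r -> sg * ((b s * c s - a s * d s) * (a 0 * c 0 + b 0 * d 0) -
     (a s * c s + b s * d s) * (b 0 * c 0 - a 0 * d 0)) <= 0) ->
  exists k : R[i], Complex (da 0) (db 0) = k * Complex (a 0) (b 0) /\
    Complex (dc 0) (dd 0) = k * Complex (c 0) (d 0).
Proof.
move=> r0 sg0 Hd nE n0 Hsg.
have r00 : `|0 : R| < r by rewrite normr0.
have [Ha [Hb [Hc Hd0]]] := Hd 0 r00.
have locmax (p q u v : R) :
    (forall s : R, `|s| < r -> (b s * c s - a s * d s) * p + (a s * c s + b s * d s) * q +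
      (a s * a s + b s * b s) * u + (c s * c s + d s * d s) * v <=
      (b 0 * c 0 - a 0 * d 0) * p + (a 0 * c 0 + b 0 * d 0) * q +
      (a 0 * a 0 + b 0 * b 0) * u + (c 0 * c 0 + d 0 * d 0) * v) ->
     (db 0 * c 0 + b 0 * dc 0 - da 0 * d 0 - a 0 * dd 0) * p +
      (da 0 * c 0 + a 0 * dc 0 + db 0 * d 0 + b 0 * dd 0) * q +
      (da 0 * a 0 + a 0 * da 0 + db 0 * b 0 + b 0 * db 0) * u +
      (dc 0 * c 0 + c 0 * dc 0 + dd 0 * d 0 + d 0 * dd 0) * v = 0.
  move=> H; apply: (local_max_deriv r0 _ (is_derive_quad p q u v Ha Hb Hc Hd0) H) => s sr.
  have [Ha' [Hb' [Hc' Hd']]] := Hd s sr.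
  by have [] := is_derive_quad p q u v Ha' Hb' Hc' Hd'.
(* [|z| ^ 2 - |w| ^ 2] is constant, so its derivative vanishes; this equates the real parts of
   [z' / z] and [w' / w]. *)
have E1 : da 0 * a 0 + db 0 * b 0 = dc 0 * c 0 + dd 0 * d 0.
  have := locmax 0 0 1 (-1); rewrite !mulr0 !add0r !mulr1 !mulrN1 => H.
  have : (da 0 * a 0 + a 0 * da 0 + db 0 * b 0 + b 0 * db 0) -
      (dc 0 * c 0 + c 0 * dc 0 + dd 0 * d 0 + d 0 * dd 0) = 0.
    by apply: H => s sr; rewrite !mulr0 !add0r (nE s sr) (nE 0 r00) mulr1 mulrN1 !subrr.
  by lra.
pose f0 := a 0 * c 0 + b 0 * d 0; pose g0 := b 0 * c 0 - a 0 * d 0.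
have E2 : (db 0 * c 0 + b 0 * dc 0 - da 0 * d 0 - a 0 * dd 0) * f0 =
   (da 0 * c 0 + a 0 * dc 0 + db 0 * d 0 + b 0 * dd 0) * g0.
  have := locmax (sg * f0) (- (sg * g0)) 0 0; rewrite !mulr0 !addr0 => H.
  apply: (mulfI sg0); apply/eqP; rewrite -subr_eq0; apply/eqP; rewrite -[RHS]H.
    by ring.
  move=> s sr; rewrite !mulr0 !addr0; have := Hsg s sr; rewrite -/f0 -/g0 => h.
  have -> : g0 * (sg * f0) + f0 * - (sg * g0) = 0 by ring.
  apply: le_trans h; rewrite le_eqVlt; apply/orP; left; apply/eqP; ring.
have nz := nE 0 r00.
(* Equality of the imaginary parts of [z' / z] and [w' / w], cleared of the common denominator. *)
have E3 : db 0 * a 0 - da 0 * b 0 = dd 0 * c 0 - dc 0 * d 0.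
  have Ef : (db 0 * c 0 + b 0 * dc 0 - da 0 * d 0 - a 0 * dd 0) * f0 -
     (da 0 * c 0 + a 0 * dc 0 + db 0 * d 0 + b 0 * dd 0) * g0 =
     (c 0 * c 0 + d 0 * d 0) * (db 0 * a 0 - da 0 * b 0) -
     (a 0 * a 0 + b 0 * b 0) * (dd 0 * c 0 - dc 0 * d 0).
    by rewrite /f0 /g0; ring.
  move: Ef; rewrite E2 subrr nz -mulrBr => /esym/eqP.
  by rewrite mulf_eq0 gt_eqF//= subr_eq0 => /eqP ->.
exists (Complex ((da 0 * a 0 + db 0 * b 0) / (a 0 * a 0 + b 0 * b 0))
                ((db 0 * a 0 - da 0 * b 0) / (a 0 * a 0 + b 0 * b 0))).
have n1 : a 0 * a 0 + b 0 * b 0 != 0 by rewrite nz gt_eqF.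
have n2 : c 0 * c 0 + d 0 * d 0 != 0 by rewrite gt_eqF.
split; first by simpc; congr Complex; field.
by rewrite E1 E3 nz; simpc; congr Complex; field.
Qed.

Lemma pair_eqP (A B : Type) (u v : A * B) : u.1 = v.1 -> u.2 = v.2 -> u = v.
Proof. by case: u v => ? ? [? ?] /= -> ->. Qed.

(** * The argument of z / w on a totally real disc *)

Section Disc.
Variables (R : realType) (U : set 'rV[R]_2) (phi : 'rV[R]_2 -> 'rV[R]_4).
Hypotheses (phiC1 : C1_on U phi) (DU : @closed_unit_disc R `<=` U).
Hypothesis phi_inj : {in @closed_unit_disc R &, injective phi}.
Hypothesis phi_tr : forall x, closed_unit_disc x -> immersive_totally_real_at phi x.
Local Notation D := (@unit_disc R).

Definition row2 (x : R * R) : 'rV[R]_2 := \row_(j < 2) (if j == ord0 then x.1 else x.2).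

Lemma row2E x : row2 x ord0 ord0 = x.1 /\ row2 x ord0 (1%:R : 'I_2) = x.2.
Proof. by rewrite !mxE. Qed.

Lemma ord2P (j : 'I_2) : j = ord0 \/ j = 1%:R.
Proof. by case: j => -[|[|//]] p; [left|right]; apply: val_inj. Qed.

Lemma row2_inj : injective row2.
Proof.
move=> x y E; have [x1 x2] := row2E x; have [y1 y2] := row2E y.
by rewrite [x]surjective_pairing [y]surjective_pairing -x1 -x2 -y1 -y2 E.
Qed.

Lemma closed_unit_disc_row2 x : closed_unit_disc (row2 x) <-> D x.
Proof. by rewrite /closed_unit_disc /=; have [-> ->] := row2E x. Qed.

Lemma row2_surj (u : 'rV[R]_2) : exists x, row2 x = u.
Proof.
exists (u ord0 ord0, u ord0 1%:R); apply/rowP => j; rewrite mxE.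
by have [->|->] := ord2P j.
Qed.

Lemma continuous_row2 : continuous row2.
Proof.
move=> x; apply/cvg_ballP => e e0.
suff : nbhs x (fun y => ball (row2 x) e (row2 y)) by [].
apply/nbhs_ballP; exists e => //= y [xy1 xy2].
by split => // i j; rewrite (ord1 i) !mxE; case: ifP.
Qed.

Definition disc_map (x : R * R) : C2 R := toC2 (phi (row2 x)).

Lemma disc_map_image : (@toC2 R \o phi) @` @closed_unit_disc R = disc_map @` D.
Proof.
apply/seteqP; split => [_ [u Du <-]|_ [x Dx <-]].
  by have [x xu] := row2_surj u; exists x; rewrite /disc_map /= ?xu// -closed_unit_disc_row2 xu.
by exists (row2 x) => //; apply/closed_unit_disc_row2.
Qed.

Lemma disc_map_inj : {in D &, injective disc_map}.
Proof.
move=> x y; rewrite !inE => Dx Dy /toC2_inj E.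
by apply: row2_inj; apply: phi_inj; rewrite // inE; apply/closed_unit_disc_row2.
Qed.

Lemma continuous_phi j : {within D, continuous (fun x => phi (row2 x) ord0 j)}.
Proof.
apply: continuous_in_subspaceT => x; rewrite inE => Dx.
apply: (@continuous_comp _ _ _ row2 (fun u => phi u ord0 j)); first exact: continuous_row2.
have Ux : U (row2 x) by apply: DU; apply/closed_unit_disc_row2.
exact: (C1_on_continuous phiC1 Ux).
Qed.

Lemma ccontinuous_disc_map :
  ccontinuous (fun x : subspace D => (disc_map x).1) /\
  ccontinuous (fun x : subspace D => (disc_map x).2).
Proof. by do 2![split]; exact: continuous_phi. Qed.

Hypothesis KM : disc_map @` D `<=` @Mcone R.

(** Real part of [z] times the conjugate of [w]; with [cross_im] it has the argument of [z / w],
    without a division. *)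
Let cross_re x := re (disc_map x).1 * re (disc_map x).2 + im (disc_map x).1 * im (disc_map x).2.
Let cross_im x := im (disc_map x).1 * re (disc_map x).2 - re (disc_map x).1 * im (disc_map x).2.

Let norm_eq x : D x -> re (disc_map x).1 ^+ 2 + im (disc_map x).1 ^+ 2 =
  re (disc_map x).2 ^+ 2 + im (disc_map x).2 ^+ 2.
Proof.
move=> Dx; have [E _] : Mcone (disc_map x) by apply: KM; exists x.
by rewrite -!cmod_sqr E.
Qed.

Let norm_gt0 x : D x -> 0 < re (disc_map x).2 ^+ 2 + im (disc_map x).2 ^+ 2.
Proof.
move=> Dx; have /Mcone_neq0[_ w0] : Mcone (disc_map x) by apply: KM; exists x.
by rewrite -cmod_sqr exprn_gt0// cmod_gt0.
Qed.

Let cross_continuous : {within D, continuous cross_re} /\ {within D, continuous cross_im}.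
Proof.
have [[c1 c2] [c3 c4]] := ccontinuous_disc_map.
split => x.
  by apply: cvgD; apply: cvgM; [exact: c1|exact: c3|exact: c2|exact: c4].
by apply: cvgB; apply: cvgM; [exact: c2|exact: c3|exact: c1|exact: c4].
Qed.

Let angle_exists : has_arg D cross_re cross_im.
Proof.
have [c1 c2] := cross_continuous.
apply: has_arg_planar => //.
- exact: compact_unit_disc.
- move=> x Dx; have := norm_gt0 Dx; have := norm_eq Dx; rewrite /cross_re /cross_im.
  move: (disc_map x) => [[a b] [c d]] /= E nz.
  have -> : (a * c + b * d) ^+ 2 + (b * c - a * d) ^+ 2 =
    (a ^+ 2 + b ^+ 2) * (c ^+ 2 + d ^+ 2) by ring.
  by rewrite E mulr_gt0.
- by move=> a; exact: has_arg_outside_disc.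
Qed.

Let shiftp (x : R * R) (i : 'I_2) (s : R) : R * R :=
  if i == ord0 then (x.1 + s, x.2) else (x.1, x.2 + s).

Let row2_shiftp x i s : s *: e2 R i + row2 x = row2 (shiftp x i s).
Proof.
apply/rowP => j; rewrite !mxE /shiftp.
have [->|->] := ord2P i; have [->|->] := ord2P j; rewrite /= ?mulr1 ?mulr0 ?add0r//.
  exact: addrC.
exact: addrC.
Qed.

(* If the tangent vector in direction [i] annihilates [arg (z / w)] and
   preserves [|z| = |w|], it lies in the complex line through the point. *)
Let tangent_parallel h x0 (r sg : R) (i : 'I_2) : {within D, continuous h} ->
  (forall x, D x -> polar (cross_re x) (cross_im x) (h x)) ->
  0 < r -> sg = 1 \/ sg = -1 -> ball x0 r `<=` D ->
  (forall x, ball x0 r x -> sg * h x <= sg * h x0) ->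
  exists k : R[i], toC2 ('D_(e2 R i) phi (row2 x0)) = (k * (disc_map x0).1, k * (disc_map x0).2).
Proof.
move=> hc Hh r0 sg1 bD hmax.
have Dx0 : D x0 by apply: bD; exact: ballxx.
(* Within distance [pi] of [h x0], the sine of [h - h x0] has the sign of [h - h x0]; the extremum
   of [h] thus becomes one of an expression polynomial in the coordinates. *)
have [r' r'0 Hr'] : exists2 r' : R, 0 < r' & forall x, ball x0 r' x ->
    ball x0 r x /\ `|h x0 - h x| < pi.
  have := (subspace_continuousP _ _).1 hc x0 Dx0.
  move=> /cvgrPdist_lt/(_ _ (pi_gt0 R)); rewrite near_withinE => /nbhs_ballP[s /= s0 Hs].
  exists (Num.min r s); first by rewrite lt_min r0.
  move=> x xb; have xr : ball x0 r x by apply: le_ball xb; rewrite ge_min lexx.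
  by split => //; apply: Hs; [apply: le_ball xb; rewrite ge_min lexx orbT|exact: bD].
have shb s : `|s| < r' -> ball x0 r' (shiftp x0 i s).
  move=> sr; rewrite /shiftp; case: ifP => _; split; rewrite /ball /= ?subrr ?normr0//.
    by rewrite opprD addrA subrr add0r normrN.
  by rewrite opprD addrA subrr add0r normrN.
have sh0 : shiftp x0 i 0 = x0 by rewrite /shiftp !addr0; case: ifP; case: (x0).
pose co j s := phi (s *: e2 R i + row2 x0) ord0 j.
pose dco j s := ('D_(e2 R i) phi (s *: e2 R i + row2 x0)) ord0 j.
have coD j (s : R) : `|s| < r' -> is_derive s 1 (co j) (dco j s).
  move=> sr; have Us : U (s *: e2 R i + row2 x0).
    rewrite row2_shiftp; apply: DU; apply/closed_unit_disc_row2; apply: bD.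
    exact: (Hr' _ (shb s sr)).1.
  have [_ /(_ i)[/(_ _ Us) dphi _]] := phiC1.
  have -> : dco j s = 'D_(e2 R i) (fun y => phi y ord0 j) (s *: e2 R i + row2 x0).
    by rewrite /dco derive_mx ?mxE.
  by apply: (@is_derive_line R (fun y => phi y ord0 j)); exact: (derivable_mxP _ _ _).1.
pose a := co (0%:R : 'I_4); pose b := co (1%:R : 'I_4).
pose c := co (2%:R : 'I_4); pose d := co (3%:R : 'I_4).
have coE s : re (disc_map (shiftp x0 i s)).1 = a s /\ im (disc_map (shiftp x0 i s)).1 = b s /\
    re (disc_map (shiftp x0 i s)).2 = c s /\ im (disc_map (shiftp x0 i s)).2 = d s.
  by rewrite /disc_map -row2_shiftp.
have Ds s : `|s| < r' -> D (shiftp x0 i s) by move=> sr; apply: bD; exact: (Hr' _ (shb s sr)).1.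
have [Z1 [Z2 [Z3 Z4]]] := coE 0; rewrite sh0 in Z1 Z2 Z3 Z4.
have sgN0 : sg != 0 by case: sg1 => ->; rewrite ?oppr_eq0 oner_neq0.
have [||||k [K1 K2]] := @curve_parallel R a b c d (dco (0%:R : 'I_4)) (dco (1%:R : 'I_4))
  (dco (2%:R : 'I_4)) (dco (3%:R : 'I_4)) r' sg r'0 sgN0.
- by move=> s sr; do 3![split; first exact: coD]; exact: coD.
- move=> s sr; have := norm_eq (Ds s sr); have [-> [-> [-> ->]]] := coE s.
  by rewrite !expr2.
- by have := norm_gt0 Dx0; rewrite Z3 Z4 !expr2.
- move=> s sr.
  have [rs rs0 [F1 F2]] := Hh _ (Ds s sr).
  have [rz rz0 [F3 F4]] := Hh _ Dx0.
  move: F1 F2 F3 F4; rewrite /cross_re /cross_im Z1 Z2 Z3 Z4.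
  have [-> [-> [-> ->]]] := coE s => -> -> -> ->.
  set hs := h (shiftp x0 i s).
  have -> : sg * (rs * sin hs * (rz * cos (h x0)) - rs * cos hs * (rz * sin (h x0))) =
    - (rs * rz * (- (sg * sin (hs - h x0)))) by rewrite sinB; ring.
  rewrite oppr_le0; apply: mulr_ge0; first by apply: mulr_ge0; exact: ltW.
  have [xb /ltW] := Hr' _ (shb s sr); rewrite ler_norml => /andP[h1 h2].
  have := hmax _ xb; rewrite -/hs in h1 h2 * => hle.
  have -> : - (sg * sin (hs - h x0)) = sin (sg * (h x0 - hs)).
    by case: sg1 => ->; rewrite ?mul1r ?mulN1r ?opprK -?sinN opprB.
  apply: sin_ge0_pi; case: sg1 hle => ->; rewrite ?mul1r ?mulN1r => hle;
    by apply/andP; split; lra.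
exists k.
have -> : (disc_map x0).1 = Complex (a 0) (b 0) by rewrite -Z1 -Z2; case: (_.1).
have -> : (disc_map x0).2 = Complex (c 0) (d 0) by rewrite -Z3 -Z4; case: (_.2).
by rewrite -K1 -K2 /dco scale0r add0r.
Qed.

Let angle_no_extremum h : {within D, continuous h} ->
  (forall x, D x -> polar (cross_re x) (cross_im x) (h x)) ->
  forall x0 (r sg : R), 0 < r -> sg = 1 \/ sg = -1 ->
  ball x0 r `<=` D -> (forall x, ball x0 r x -> sg * h x <= sg * h x0) -> False.
Proof.
move=> hc Hh x0 r sg r0 sg1 bD hmax.
have Dx0 : closed_unit_disc (row2 x0).
  by apply/closed_unit_disc_row2; apply: bD; exact: ballxx.
have [k1 H1] := tangent_parallel ord0 hc Hh r0 sg1 bD hmax.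
have [k2 H2] := tangent_parallel 1%:R hc Hh r0 sg1 bD hmax.
exact: not_totally_real_of_parallel (phi_tr Dx0) H1 H2.
Qed.

(** The fiber is the union of the level sets of [h] at the values [c] with [exp (i c) = p.1 / p.2],
    which are spaced by [2 pi]. On it [w = p.2] would force [z = p.1], so [w - p.2] has no zero
    there. *)
Lemma fiber_has_arg (p : C2 R) : p.1 != 0 -> p.2 != 0 -> ~ (disc_map @` D) p ->
  has_arg (D `&` [set x | (disc_map x).1 * p.2 = (disc_map x).2 * p.1])
    (fun x => re (disc_map x).2 - re p.2) (fun x => im (disc_map x).2 - im p.2).
Proof.
move=> p10 p20 pK.
have [h hc Hh] := angle_exists.
pose P (c : R) := Complex (cos c) (sin c) * p.2 = p.1.
have zE x : D x -> (disc_map x).1 = Complex (cos (h x)) (sin (h x)) * (disc_map x).2.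
  move=> Dx; have [r r0 [E1 E2]] := Hh x Dx.
  have := norm_gt0 Dx; have := norm_eq Dx; move: E1 E2; rewrite /cross_re /cross_im.
  move: (disc_map x) => [[a b] [c d]] /= E1 E2 E3 n0.
  have rn : r = c ^+ 2 + d ^+ 2.
    apply/eqP; rewrite -(@eqrXn2 _ 2) ?(ltW r0) ?(ltW n0)//; apply/eqP.
    have -> : r ^+ 2 = (r * cos (h x)) ^+ 2 + (r * sin (h x)) ^+ 2.
      by rewrite !exprMn -mulrDr cos2Dsin2 mulr1.
    rewrite -E1 -E2; have -> : (a * c + b * d) ^+ 2 + (b * c - a * d) ^+ 2 =
      (a ^+ 2 + b ^+ 2) * (c ^+ 2 + d ^+ 2) by ring.
    by rewrite E3 expr2.
  have rN0 : r != 0 by rewrite gt_eqF.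
  simpc; congr Complex; apply: (mulfI rN0).
    have -> : r * (cos (h x) * c - sin (h x) * d) =
      (r * cos (h x)) * c - (r * sin (h x)) * d by ring.
    by rewrite -E1 -E2 rn; ring.
  have -> : r * (cos (h x) * d + sin (h x) * c) = (r * cos (h x)) * d + (r * sin (h x)) * c by ring.
  by rewrite -E1 -E2 rn; ring.
have w0 x : D x -> (disc_map x).2 != 0.
  by move=> Dx; have /Mcone_neq0[] : Mcone (disc_map x) by apply: KM; exists x.
have fiberP x : D x -> (disc_map x).1 * p.2 = (disc_map x).2 * p.1 <-> P (h x).
  move=> Dx; rewrite zE// /P; split => [E|<-]; last by ring.
  by apply: (mulfI (w0 x Dx)); rewrite -E; ring.
have -> : D `&` [set x | (disc_map x).1 * p.2 = (disc_map x).2 * p.1] =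
    D `&` [set x | P (h x)].
  by apply/seteqP; split => x [Dx /= H]; split => //; apply/(fiberP x Dx).
have [_ [c3 c4]] := ccontinuous_disc_map.
have p0 : 0 < (pi : R) *+ 2 by rewrite pmulrn_lgt0// pi_gt0.
apply: (has_arg_levels hc (angle_no_extremum hc Hh) p0).
- by move=> x; apply: cvgB; [exact: c3|exact: cvg_cst].
- by move=> x; apply: cvgB; [exact: c4|exact: cvg_cst].
- move=> c d Pc Pd; have := etrans Pc (esym Pd) => /(mulIf p20)[E1 E2].
  have pc : polar (cos c) (sin c) c by exists 1; rewrite ?mul1r.
  have pd : polar (cos c) (sin c) d by exists 1; rewrite ?mul1r.
  have [k Hk] := polar_uniq pc pd.
  rewrite Hk normrM [X in _ * X](gtr0_norm p0) gtr_pMl//.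
  rewrite -intr_norm ltrz1 -[X in _ < X]add0r ltzD1 normr_le0 => /eqP k0.
  by apply/eqP; rewrite -subr_eq0 Hk k0 mul0r.
- move=> x Dx Px; rewrite lt_def addr_ge0 ?sqr_ge0// andbT paddr_eq0 ?sqr_ge0//.
  rewrite !sqrf_eq0 !subr_eq0; apply/negP => /andP[/eqP R1 /eqP I1]; apply: pK.
  have E2 : (disc_map x).2 = p.2.
    by move: R1 I1; case: (_.2) => ? ?; case: (p.2) => ? ? /= -> ->.
  have E1 : (disc_map x).1 = p.1.
    by apply: (mulIf p20); rewrite (fiberP x Dx).2// E2 mulrC.
  by exists x => //; apply: pair_eqP.
Qed.

Lemma disc_hull_sub : poly_hull (disc_map @` D) `&` @axes R = set0 ->
  poly_hull (disc_map @` D) `<=` disc_map @` D.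
Proof.
move=> Kaxes p Hp; apply: contrapT => pK.
have [k1 k2] := ccontinuous_disc_map.
have cD := @compact_unit_disc R.
have D0 : D !=set0 by exists (0, 0); rewrite /unit_disc /= expr0n /= addr0 ler01.
have : ~ axes p by move=> Ap; have : (set0 : set (C2 R)) p by rewrite -Kaxes.
rewrite /axes /= => /eqP; rewrite mulf_eq0 negb_or => /andP[p10 p20].
pose S := D `&` [set x | (disc_map x).1 * p.2 = (disc_map x).2 * p.1].
have cS : compact S.
  have gc : {within D, continuous (fun x => - cmod ((disc_map x).1 * p.2 - (disc_map x).2 * p.1))}.
    move=> x; apply: cvgN; apply: (continuous_cmod (T := subspace D)).
    by apply: ccontinuousB; apply: ccontinuousM => //; exact: ccontinuous_cst.
  have -> : S = D `&` [set x | 0 <= - cmod ((disc_map x).1 * p.2 - (disc_map x).2 * p.1)].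
    apply/seteqP; split => x [Dx /= H]; split => //=.
      by rewrite H subrr cmod0 oppr0.
    apply/eqP; rewrite -subr_eq0; apply/eqP; apply: cmod_eq0.
    by apply/eqP; rewrite eq_le cmod_ge0 andbT -oppr_ge0.
  exact: compact_superlevel.
(* On the fiber [w] determines [z], so the projection to the w-plane is injective. *)
pose G x : R * R := (re (disc_map x).2, im (disc_map x).2).
have Gc : {within S, continuous G}.
  have SD : S `<=` D by move=> x [].
  have [h1 h2] := k2.
  have g1 : {within S, continuous (fun x => re (disc_map x).2)} := continuous_subspaceW SD h1.
  have g2 : {within S, continuous (fun x => im (disc_map x).2)} := continuous_subspaceW SD h2.
  by move=> x; exact: (cvg_pair (g1 x) (g2 x)).
have GE x : toC (G x) = (disc_map x).2 by rewrite /toC /G; case: (_.2).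
have Ginj : {in S &, injective G}.
  move=> x y; rewrite !inE => -[Dx /= Ex] [Dy /= Ey] Gxy.
  have E2 : (disc_map x).2 = (disc_map y).2 by rewrite -!GE Gxy.
  apply: disc_map_inj; rewrite ?inE//; apply: pair_eqP => //.
  by apply: (mulIf p20); exact: etrans Ex (etrans (congr1 ( *%R^~ p.1) E2) (esym Ey)).
pose q : R * R := (re p.2, im p.2).
have qE : toC q = p.2 by rewrite /toC /q; case: (p.2).
apply: (@planar_hull_no_arg R (G @` S) q).
- exact: continuous_compact.
- move=> Q B B0 HB; rewrite qE.
  apply: (hull_fiber D0 cD k1 k2 KM Kaxes Hp B0) => x Dx Ex.
  by rewrite -GE; apply: HB; exists x.
- move=> [x [Dx /= Ex] Gx]; apply: pK; exists x => //.
  have E2 : (disc_map x).2 = p.2 by rewrite -GE Gx qE.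
  apply: pair_eqP => //; apply: (mulIf p20).
  exact: etrans Ex (etrans (congr1 ( *%R^~ p.1) E2) (mulrC _ _)).
- apply: (has_arg_image _ cS Gc Ginj); first exact: pair_hausdorff.
  exact: fiber_has_arg.
Qed.

End Disc.

Theorem theorem1p6 (R : realType) (K : set (C2 R)) :
  totally_real_disc K -> K `<=` @Mcone R ->
  (poly_convex K <-> poly_hull K `&` @axes R = set0).
Proof.
move=> [U [phi [phiC1 [DU [phi_inj [phi_tr KE]]]]]] KM.
split => [KK|Kaxes].
  (* If [K] is its own hull, it suffices that M does not meet the axes: where [|z| = |w|], one
     vanishing coordinate forces the origin. *)
  rewrite KK; apply/seteqP; split => // p [/KM /Mcone_neq0[p1 p2]] /eqP.
  by rewrite mulf_eq0 (negbTE p1) (negbTE p2).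
rewrite KE disc_map_image in KM Kaxes *.
apply/seteqP; split; first exact: (disc_hull_sub phiC1 DU phi_inj phi_tr KM Kaxes).
have D0 : @unit_disc R !=set0 by exists (0, 0); rewrite /unit_disc /= expr0n /= addr0 ler01.
have [k1 k2] := ccontinuous_disc_map phiC1 DU.
apply: sub_poly_hull; first by have [x Dx] := D0; exists (disc_map phi x), x.
move=> P; have [B HB] := continuous_on_bounded (@compact_unit_disc R)
  (continuous_cmod (ccontinuous_pev P k1 k2)).
by exists B => _ [x Dx <-]; exact: HB.
Qed.
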